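(* If $f \in \mathsf{RO}$, then there exist inner functions $\phi_n^+$ and $\phi_n^-$ ($n\ge1$) so that $$f = |f(0)| \prod_{n \geq 1} \left(\frac{1 -i \phi_n^+}{1 + i \phi_n^+} \right) \left(\frac{1 + i \phi_n^-}{1 - i \phi_n^-} \right),$$ where the product converges locally uniformly on $\mathbb{D}$.
   Context: $\mathbb{D}$ is the open unit disk, $\mathbb{T}$ the unit circle. The Smirnov class is $N^+ = \{f/g : f,g \in H^\infty,\ g \text{ outer}\}$, and $\mathsf{RO}$ is the set of outer functions in $N^+$ whose radial boundary values are real a.e.~on $\mathbb{T}$. *)

(* Defs.v *)
From HB Require Import structures.
From mathcomp Require Import all_boot all_order all_algebra.
From mathcomp Require Import all_classical all_reals all_analysis.
From mathcomp Require Import complex.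
Set Implicit Arguments. Unset Strict Implicit. Unset Printing Implicit Defensive.
Import Order.TTheory GRing.Theory Num.Theory.
Import numFieldTopology.Exports numFieldNormedType.Exports.
Local Open Scope classical_set_scope.
Local Open Scope ring_scope.
Local Open Scope complex_scope.

(* topology / normed structure on the complex numbers R[i], induced by the norm *)
HB.instance Definition _ (R : rcfType) :=
  PseudoPointedMetric.copy (complex R) (complex R)^o.

Section Hardy.
Variable R : realType.
Local Notation C := R[i].

Definition disk : set C := [set z | `|z| < 1].

Definition expi (t : R) : C := (cos t) +i* (sin t).

Definition cexp (w : C) : C := ((expR (complex.Re w))%:C * expi (complex.Im w))%R.

Definition holo_disk (f : C -> C) : Prop :=
  forall z, disk z ->
    exists l : C, (fun w => (f w - f z) / (w - z)) @ z^' --> l.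

Definition Hinf (f : C -> C) : Prop :=
  holo_disk f /\ exists M : R, forall z, disk z -> `|f z| <= M%:C.

Definition radlim (f : C -> C) (t : R) (l : C) : Prop :=
  (fun r : R => f (r%:C * expi t)) @ (1%R)^'- --> l.

Definition ae_circle (P : R -> Prop) : Prop :=
  {ae (@lebesgue_measure R), forall t, `[0%R, (2 * pi)%R]%classic t -> P t}.

Definition herglotz (t : R) (z : C) : C := (expi t + z) / (expi t - z).

Definition herglotz_int (u : R -> R) (z : C) : C :=
  ((Rintegral (@lebesgue_measure R) `[0%R, (2 * pi)%R]%classic
       (fun t => complex.Re (herglotz t z) * u t)) / (2 * pi))
  +i*
  ((Rintegral (@lebesgue_measure R) `[0%R, (2 * pi)%R]%classic
       (fun t => complex.Im (herglotz t z) * u t)) / (2 * pi)).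

Definition outer (f : C -> C) : Prop :=
  exists (c : C) (k : R -> R),
    `|c| = 1 /\ (forall t, 0 < k t)%R /\
    measurable_fun `[0%R, (2 * pi)%R]%classic (fun t => ln (k t)) /\
    (@lebesgue_measure R).-integrable `[0%R, (2 * pi)%R]%classic
       (fun t => (ln (k t))%:E) /\
    forall z, disk z -> f z = c * cexp (herglotz_int (fun t => ln (k t)) z).

Definition inner (f : C -> C) : Prop :=
  Hinf f /\ ae_circle (fun t => exists l : C, radlim f t l /\ `|l| = 1).

Definition Nplus (f : C -> C) : Prop :=
  exists F G : C -> C, Hinf F /\ Hinf G /\ outer G /\
    forall z, disk z -> f z = F z / G z.

Definition RO (f : C -> C) : Prop :=
  Nplus f /\ outer f /\ ae_circle (fun t => exists l : R, radlim f t l%:C).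

(* partial products of the infinite product (factor n corresponds to index n+1) *)
Definition ROprod (f0 : C) (pp pm : nat -> C -> C) (N : nat) (z : C) : C :=
  f0 * \prod_(n < N)
     (((1 - 'i * pp n z) / (1 + 'i * pp n z)) *
      ((1 + 'i * pm n z) / (1 - 'i * pm n z))).

End Hardy.

(* Main.v *)
Require Import Defs.
From HB Require Import structures.
From mathcomp Require Import all_boot all_order all_algebra.
From mathcomp Require Import all_classical all_reals all_analysis.
From mathcomp Require Import complex.
From mathcomp Require Import measurable_realfun.
From mathcomp Require Import ring lra.
Import Order.TTheory GRing.Theory Num.Theory.
Import numFieldTopology.Exports numFieldNormedType.Exports.
Local Open Scope classical_set_scope.
Local Open Scope ring_scope.
Local Open Scope complex_scope.

(** Write f = |f(0)| c exp(sum_{m>=1} a_m z^m) with |c| = 1; the a_m are bounded,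
being Fourier coefficients of the integrable function log|f|. Monomials zeta z^k
with |zeta| = 1 are inner, and the logarithm of the factor built from
phi^+ = zeta z^k and phi^- = zeta' z^k is
  sum_j (1 - (-1)^j) i^j (zeta'^j - zeta^j) z^(kj) / j.
Its z^k coefficient 2i(zeta' - zeta) can be any complex number d with |d| <= 4,
and its other coefficients, which sit at multiples of k, have modulus at most |d|.
After a first pair of Moebius factors has produced the constant c, the remaining
coefficients are cancelled one exponent after another, the exponent k being used
n k^2 times in a row. The inequality 1 + sum_{i | m, i < m} i^2 <= m^2 shows that
the coefficient of z^m in the logarithm of the residual quotient never exceeds
n m^2; once the exponents below k are exhausted that logarithm is therefore at
most a tail of n sum m^2 |z|^m, which tends to 0 uniformly on compact sets. *)

Set Implicit Arguments.
Unset Strict Implicit.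
Unset Printing Implicit Defensive.

(** * Modulus, exponential and derivatives along the real line of complex-valued functions *)

Section ComplexExp.
Variable R : realType.
Local Notation C := R[i].
Implicit Types (z w : C) (x y : R).

(* The modulus as an element of R; [`|z|] itself is an element of R[i]. *)
Local Notation nm := (@ComplexField.Normc.normc R).

Lemma normE z : `|z| = (nm z)%:C. Proof. by []. Qed.

Lemma nm_ge0 z : 0 <= nm z.
Proof. by rewrite -lecR -normE normr_ge0. Qed.

Lemma nmM z w : nm (z * w) = nm z * nm w.
Proof. exact: ComplexField.Normc.normcM. Qed.

Lemma nmV z : nm z^-1 = (nm z)^-1.
Proof. exact: ComplexField.Normc.normcV. Qed.

Lemma nmD z w : nm (z + w) <= nm z + nm w.
Proof. by rewrite -lecR rmorphD /= -!normE ler_normD. Qed.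

Lemma nmN z : nm (- z) = nm z.
Proof. by apply: complexI; rewrite -!normE normrN. Qed.

Lemma nmB z w : nm (z - w) <= nm z + nm w.
Proof. by rewrite -(nmN w) nmD. Qed.

Lemma nmX z n : nm (z ^+ n) = nm z ^+ n.
Proof. by apply: complexI; rewrite -normE normrX rmorphXn. Qed.

Lemma nm_sum (I : Type) (r : seq I) (P : pred I) (F : I -> C) :
  nm (\sum_(i <- r | P i) F i) <= \sum_(i <- r | P i) nm (F i).
Proof. by rewrite -lecR rmorph_sum /= -normE; apply: ler_norm_sum. Qed.

Lemma nm_real x : nm x%:C = `|x|.
Proof. by rewrite /= expr0n addr0 sqrtr_sqr. Qed.

Lemma nm0 : nm 0 = 0. Proof. by rewrite nm_real normr0. Qed.
Lemma nm1 : nm 1 = 1. Proof. by rewrite nm_real normr1. Qed.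

Lemma nm_eq0 z : (nm z == 0) = (z == 0).
Proof. by rewrite -(inj_eq (@complexI R)) -normE normr_eq0. Qed.

Lemma nm_nat n : nm n%:R = n%:R.
Proof. by apply: complexI; rewrite -normE normr_nat rmorph_nat. Qed.

Lemma nm_i : nm 'i%C = 1.
Proof. by rewrite /= expr0n expr1n add0r sqrtr1. Qed.

Lemma Re_le_nm z : `|complex.Re z| <= nm z.
Proof. by rewrite -lecR -normE; apply: normc_ge_Re. Qed.

Lemma Im_le_nm z : `|complex.Im z| <= nm z.
Proof.
by rewrite -[nm z]mulr1 -nm_i -nmM (le_trans _ (Re_le_nm _)) // ReiNIm normrN.
Qed.

Lemma nm_le_ReIm z : nm z <= `|complex.Re z| + `|complex.Im z|.
Proof.
case: z => a b.
have {1}-> : a +i* b = a%:C + 'i%C * b%:C by apply: (complexE (a +i* b)).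
by rewrite (le_trans (nmD _ _)) // nmM nm_i mul1r !nm_real.
Qed.

Lemma diskE z : disk z <-> nm z < 1.
Proof. by rewrite /disk /= normE -ltcR. Qed.

Lemma cvg_nmP (T : Type) (F : set_system T) (FF : Filter F) (u : T -> C) (l : C) :
  u @ F --> l <-> forall e : R, 0 < e -> \forall t \near F, nm (u t - l) < e.
Proof.
split=> [/(@cvgrPdist_lt C C^o _ _ FF u l) h e e0|h].
  have /h : 0 < e%:C :> C by rewrite ltcR.
  by apply: filterS => t; rewrite -normrN opprB normE ltcR.
apply/(@cvgrPdist_lt C C^o _ _ FF u l) => e e0.
have er : e = (complex.Re e)%:C.
  by move: e0; rewrite ltcE /= => /andP[/eqP]; case: (e) => a b /= ->.
rewrite er in e0 *; move: e0; rewrite ltcR => /h.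
by apply: filterS => t; rewrite -normrN opprB normE ltcR.
Qed.

Lemma cexpD z w : cexp (z + w) = cexp z * cexp w.
Proof.
case: z w => a b [c d]; rewrite /cexp /expi /= expRD cosD sinD.
by apply/eqP; rewrite eq_complex /=; apply/andP; split; apply/eqP; ring.
Qed.

Lemma cexp0 : cexp 0 = 1 :> C.
Proof. by rewrite /cexp /expi /= expR0 cos0 sin0 mul1r. Qed.

Lemma cexpN z : cexp (- z) = (cexp z)^-1.
Proof.
have h : cexp z * cexp (- z) = 1 by rewrite -cexpD subrr cexp0.
have nz : cexp z != 0.
  by apply: contra_eqN h => /eqP ->; rewrite mul0r eq_sym oner_eq0.
by apply: (mulfI nz); rewrite h divff.
Qed.

Lemma nm_expi x : nm (expi x) = 1.
Proof. by rewrite /= cos2Dsin2 sqrtr1. Qed.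

Lemma nm_cexp z : nm (cexp z) = expR (complex.Re z).
Proof. by rewrite nmM nm_real nm_expi mulr1 ger0_norm ?expR_ge0. Qed.

Lemma nm_cexp_le z : nm (cexp z) <= expR (nm z).
Proof. by rewrite nm_cexp ler_expR (le_trans (ler_norm _)) ?Re_le_nm. Qed.

(* [R[i]] is not a normed module over R here, hence derivatives componentwise. *)
Definition is_cderive (x : R) (g : R -> C) (d : C) :=
  is_derive x 1 (fun t => complex.Re (g t)) (complex.Re d) /\
  is_derive x 1 (fun t => complex.Im (g t)) (complex.Im d).

Lemma is_cderive_eq x g d d' : is_cderive x g d -> d = d' -> is_cderive x g d'.
Proof. by move=> ? <-. Qed.

Lemma is_cderive_cst x w : is_cderive x (fun=> w) 0.
Proof. by split; exact: is_derive_cst. Qed.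

Lemma is_cderive_id x : is_cderive x (fun t => t%:C) 1.
Proof. by split; [exact: is_derive_id | exact: is_derive_cst]. Qed.

Lemma is_cderiveD x f g df dg : is_cderive x f df -> is_cderive x g dg ->
  is_cderive x (fun t => f t + g t) (df + dg).
Proof.
move=> [f1 f2] [g1 g2]; split.
  have -> : (fun t => complex.Re (f t + g t)) =
    (fun t => complex.Re (f t)) + (fun t => complex.Re (g t)).
    by apply/funext => t; rewrite !fctE; case: (f t) (g t) => ? ? [].
  by apply: is_derive_eq; case: (df) (dg) => ? ? [].
have -> : (fun t => complex.Im (f t + g t)) =
  (fun t => complex.Im (f t)) + (fun t => complex.Im (g t)).
  by apply/funext => t; rewrite !fctE; case: (f t) (g t) => ? ? [].
by apply: is_derive_eq; case: (df) (dg) => ? ? [].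
Qed.

Lemma is_cderiveM x f g df dg : is_cderive x f df -> is_cderive x g dg ->
  is_cderive x (fun t => f t * g t) (df * g x + f x * dg).
Proof.
move=> [f1 f2] [g1 g2]; split.
  have -> : (fun t => complex.Re (f t * g t)) =
    (fun t => complex.Re (f t)) * (fun t => complex.Re (g t)) -
    (fun t => complex.Im (f t)) * (fun t => complex.Im (g t)).
    by apply/funext => t; rewrite !fctE; case: (f t) (g t) => ? ? [].
  apply: is_derive_eq; rewrite /GRing.scale /=.
  by case: (df) (dg) (f x) (g x) => ? ? [? ?] [? ?] [? ?] /=; ring.
have -> : (fun t => complex.Im (f t * g t)) =
  (fun t => complex.Re (f t)) * (fun t => complex.Im (g t)) +
  (fun t => complex.Im (f t)) * (fun t => complex.Re (g t)).
  by apply/funext => t; rewrite !fctE; case: (f t) (g t) => ? ? [].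
apply: is_derive_eq; rewrite /GRing.scale /=.
by case: (df) (dg) (f x) (g x) => ? ? [? ?] [? ?] [? ?] /=; ring.
Qed.

Lemma is_cderive_sum x n (f : nat -> R -> C) (df : nat -> C) :
  (forall i, is_cderive x (f i) (df i)) ->
  is_cderive x (fun t => \sum_(i < n) f i t) (\sum_(i < n) df i).
Proof.
move=> h; elim: n => [|n ih].
  rewrite big_ord0 (_ : (fun _ => _) = fun=> 0); first exact: is_cderive_cst.
  by apply/funext => t; rewrite big_ord0.
rewrite big_ord_recr (_ : (fun _ => _) = fun t => \sum_(i < n) f i t + f n t).
  exact: is_cderiveD.
by apply/funext => t; rewrite big_ord_recr.
Qed.

Lemma is_cderiveX x f df n : is_cderive x f df ->
  is_cderive x (fun t => f t ^+ n.+1) (n.+1%:R * f x ^+ n * df).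
Proof.
move=> h; elim: n => [|n ih].
  rewrite (_ : (fun t => _) = f); last by apply/funext => t; rewrite expr1.
  by apply: is_cderive_eq h _; rewrite expr0 mulr1 mul1r.
rewrite (_ : (fun t => _) = fun t => f t * f t ^+ n.+1); last first.
  by apply/funext => t; rewrite exprS.
apply: is_cderive_eq (is_cderiveM h ih) _.
by rewrite !exprS -[in RHS]natr1; ring.
Qed.

Lemma is_cderive_exp x f df : is_cderive x f df ->
  is_cderive x (fun t => cexp (f t)) (df * cexp (f x)).
Proof.
move=> [f1 f2].
have e1 : is_derive x 1 (expR \o (fun t => complex.Re (f t)))
  (expR (complex.Re (f x)) * complex.Re df) by exact: is_derive1_comp.
have c1 : is_derive x 1 (cos \o (fun t => complex.Im (f t)))
  (- sin (complex.Im (f x)) * complex.Im df) by exact: is_derive1_comp.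
have s1 : is_derive x 1 (sin \o (fun t => complex.Im (f t)))
  (cos (complex.Im (f x)) * complex.Im df) by exact: is_derive1_comp.
split.
  rewrite (_ : (fun t => _) = (expR \o (fun t => complex.Re (f t))) *
     (cos \o (fun t => complex.Im (f t)))); last first.
    by apply/funext => t; rewrite !fctE /cexp /expi /=; ring.
  apply: is_derive_eq; rewrite /GRing.scale /= /cexp /expi.
  by case: (df) (f x) => ? ? [? ?] /=; ring.
rewrite (_ : (fun t => _) = (expR \o (fun t => complex.Re (f t))) *
   (sin \o (fun t => complex.Im (f t)))); last first.
  by apply/funext => t; rewrite !fctE /cexp /expi /=; ring.
apply: is_derive_eq; rewrite /GRing.scale /= /cexp /expi.
by case: (df) (f x) => ? ? [? ?] /=; ring.
Qed.

(** The real mean value theorem applied to the real and imaginary parts separately, whence the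
    factor 2. *)
Lemma complex_mean_value (g dg : R -> C) (B : R) :
  (forall x, is_cderive x g (dg x)) ->
  (forall x, 0 <= x <= 1 -> nm (dg x) <= B) -> nm (g 1 - g 0) <= 2 * B.
Proof.
move=> h hB.
have H (p : R -> R) (dp : R -> R) : (forall x, is_derive x 1 p (dp x)) ->
    (forall x, 0 <= x <= 1 -> `|dp x| <= B) -> `|p 1 - p 0| <= B.
  move=> hp hb.
  have cp : {within `[0, 1], continuous p}.
    by apply: derivable_within_continuous => x _; exact: (@ex_derive _ _ _ _ _ _ _ (hp x)).
  have [c c01 ->] := MVT_segment ler01 (fun x _ => hp x) cp.
  by rewrite subr0 mulr1 hb // -in_itv.
rewrite (le_trans (nm_le_ReIm _)) // mulr_natl mulr2n lerD //.
  have -> : complex.Re (g 1 - g 0) = complex.Re (g 1) - complex.Re (g 0).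
    by case: (g 1) (g 0) => ? ? [].
  apply: (H (fun t => complex.Re (g t)) (fun t => complex.Re (dg t))) => x.
    by case: (h x).
  by move=> /hB; apply: le_trans (Re_le_nm _).
have -> : complex.Im (g 1 - g 0) = complex.Im (g 1) - complex.Im (g 0).
  by case: (g 1) (g 0) => ? ? [].
apply: (H (fun t => complex.Im (g t)) (fun t => complex.Im (dg t))) => x.
  by case: (h x).
by move=> /hB; apply: le_trans (Im_le_nm _).
Qed.

(** Mean value estimate for t -> exp(t z) on [0, 1]; it serves to compare exponentials of nearby
    exponents. *)
Lemma nm_cexpB1 z : nm (cexp z - 1) <= 2 * (nm z * expR (nm z)).
Proof.
have := @complex_mean_value (fun t => cexp (t%:C * z))
  (fun t => z * cexp (t%:C * z)) (nm z * expR (nm z)).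
rewrite rmorph1 rmorph0 mul1r mul0r cexp0; apply => x.
  apply: is_cderive_exp.
  apply: is_cderive_eq (is_cderiveM (is_cderive_id x) (is_cderive_cst x z)) _.
  by rewrite mul1r mulr0 addr0.
move=> /andP[x0 x1]; rewrite nmM ler_wpM2l ?nm_ge0 // (le_trans (nm_cexp_le _)) //.
by rewrite ler_expR nmM nm_real ger0_norm // ler_piMl ?nm_ge0.
Qed.

End ComplexExp.

(** * Exponentials of power series on the disk *)

Section ExpPowerSeries.
Variable R : realType.
Local Notation C := R[i].
Implicit Types (z w : C) (x y : R) (a b : nat -> C) (F G : C -> C).

Local Notation nm := (@ComplexField.Normc.normc R).

Definition psum a (M : nat) z : C := \sum_(m < M) a m * z ^+ m.

(* F is exp(sum_m a m z^m) on the disk; only limits of exponentials occur, so that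
   neither the convergence of the series nor a logarithm is needed. *)
Definition explim a F :=
  forall z, disk z -> (fun M => cexp (psum a M z)) @ \oo --> F z.

Lemma geom_sum_le (r : R) n : 0 <= r < 1 -> \sum_(i < n) r ^+ i <= (1 - r)^-1.
Proof.
move=> /andP[r0 r1]; have r2 : 0 < 1 - r by rewrite subr_gt0.
rewrite -(ler_pM2l r2) divff ?gt_eqF // -opprB mulNr -subrX1 opprB.
by rewrite gerBl exprn_ge0.
Qed.

Lemma psumD a b M z : psum (fun m => a m + b m) M z = psum a M z + psum b M z.
Proof. by rewrite /psum -big_split; apply: eq_bigr => i _; rewrite mulrDl. Qed.

Lemma psumN a M z : psum (fun m => - a m) M z = - psum a M z.
Proof. by rewrite /psum -sumrN; apply: eq_bigr => i _; rewrite mulNr. Qed.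

Lemma explim_eq a b F G : explim a F -> a =1 b -> {in disk (R:=R), F =1 G} -> explim b G.
Proof.
move=> h ab FG z zD; rewrite -FG ?inE //.
by have /funext <- := ab; exact: h.
Qed.

Lemma explimD a b F G : explim a F -> explim b G ->
  explim (fun m => a m + b m) (fun z => F z * G z).
Proof.
move=> ha hb z zD.
under eq_fun do rewrite psumD cexpD.
exact: cvgM (ha z zD) (hb z zD).
Qed.

Lemma explimN a F : explim a F -> (forall z, disk z -> F z != 0) ->
  explim (fun m => - a m) (fun z => (F z)^-1).
Proof.
move=> ha F0 z zD.
under eq_fun do rewrite psumN cexpN.
exact: cvgV (F0 z zD) (ha z zD).
Qed.

Lemma explim0 : explim (fun=> 0) (fun=> 1).
Proof.
move=> z _; have -> : (fun M => cexp (psum (fun=> 0) M z)) = fun=> 1 :> C.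
  apply/funext => M; rewrite /psum big1 ?cexp0 // => i _.
  by rewrite mul0r.
exact: cvg_cst.
Qed.

(* The derivative of (1 - t w) exp(sum_{1<=j<=n} (t w)^j / j) in t is
   - w (t w)^n exp(...), so this function hardly varies on [0, 1]. *)
Lemma log_partial_sum_le w n : nm w < 1 ->
  nm ((1 - w) * cexp (\sum_(j < n.+1) w ^+ j / j%:R) - 1) <=
  2 * (nm w ^+ n * expR (1 - nm w)^-1).
Proof.
move=> w1.
pose S (t : R) : C := \sum_(i < n) (i.+1%:R)^-1 * (t%:C * w) ^+ i.+1.
pose g t := (1 + - (t%:C * w)) * cexp (S t).
pose dg t := - (w * (t%:C * w) ^+ n * cexp (S t)).
have tw t : is_cderive t (fun t => t%:C * w) w.
  apply: is_cderive_eq (is_cderiveM (is_cderive_id t) (is_cderive_cst t w)) _.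
  by rewrite mul1r mulr0 addr0.
have Sd t : is_cderive t S (\sum_(i < n) (t%:C * w) ^+ i * w).
  apply: (@is_cderive_sum _ _ n (fun i t => (i.+1%:R)^-1 * (t%:C * w) ^+ i.+1)
    (fun i => (t%:C * w) ^+ i * w)) => i.
  apply: is_cderive_eq (is_cderiveM (is_cderive_cst _ _) (is_cderiveX i (tw t))) _.
  by rewrite mul0r add0r !mulrA mulVf ?mul1r // pnatr_eq0.
have gd t : is_cderive t g (dg t).
  have h : is_cderive t (fun t => 1 + - (t%:C * w)) (- w).
    have := is_cderiveD (is_cderive_cst t 1) (is_cderiveM (is_cderive_cst t (- 1)) (tw t)).
    under eq_fun do rewrite mulN1r.
    by move=> /is_cderive_eq; apply; rewrite mul0r !add0r mulN1r.
  apply: is_cderive_eq (is_cderiveM h (is_cderive_exp (Sd t))) _.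
  rewrite /dg -mulr_suml.
  have : 1 - (t%:C * w) ^+ n = (1 - t%:C * w) * \sum_(i < n) (t%:C * w) ^+ i.
    by rewrite -opprB subrX1 -mulNr opprB.
  set A := \sum_(i < n) _ => e.
  have -> : (1 + - (t%:C * w)) * (A * w * cexp (S t)) =
    w * ((1 - t%:C * w) * A) * cexp (S t) by ring.
  by rewrite -e; ring.
(* The term j = 0 vanishes because the inverse of 0 is 0, so the sum really starts at j = 1. *)
have g1 : g 1 = (1 - w) * cexp (\sum_(j < n.+1) w ^+ j / j%:R).
  rewrite /g /S big_ord_recl invr0 mulr0 add0r rmorph1 mul1r.
  by congr (_ * cexp _); apply: eq_bigr => i _; rewrite mulrC.
have g0 : g 0 = 1.
  rewrite /g /S rmorph0 mul0r subr0 mul1r big1 ?cexp0 // => i _.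
  by rewrite exprS mul0r mulr0.
rewrite -g1 -g0; apply: complex_mean_value gd _ => t /andP[t0 t1].
have nt : nm (t%:C * w) <= nm w by rewrite nmM nm_real ger0_norm // ler_piMl ?nm_ge0.
rewrite /dg nmN 2!nmM nmX.
have W : nm w * nm (t%:C * w) ^+ n <= nm w ^+ n.
  by rewrite -[leRHS]mul1r ler_pM ?nm_ge0 ?exprn_ge0 ?nm_ge0 ?lerXn2r ?nnegrE ?nm_ge0 ?(ltW w1).
apply: ler_pM => //; first by rewrite mulr_ge0 ?exprn_ge0 ?nm_ge0.
- exact: nm_ge0.
apply: le_trans (nm_cexp_le _) _; rewrite ler_expR.
apply: le_trans (geom_sum_le n _); last by rewrite nm_ge0.
apply: le_trans (nm_sum _ _ _) _; apply: ler_sum => i _.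
rewrite nmM nmV nm_nat nmX -[leRHS]mul1r ler_pM ?exprn_ge0 ?nm_ge0 //.
  by rewrite invf_le1 ?ltr0n // ler1n.
rewrite exprS -[leRHS]mul1r ler_pM ?exprn_ge0 ?nm_ge0 //.
  exact: le_trans nt (ltW w1).
by rewrite lerXn2r ?nnegrE ?nm_ge0.
Qed.

(** With w = al z, the exponential of the M-th partial sum is (1 - w) / [u M], and [u M] tends to 1
    by [log_partial_sum_le]. *)
Lemma explim_one_sub (al : C) : nm al <= 1 ->
  explim (fun j => - (al ^+ j / j%:R)) (fun z => 1 - al * z).
Proof.
move=> al1 z /diskE z1; set w := al * z.
have w1 : nm w < 1.
  by rewrite nmM (le_lt_trans _ z1) // ler_piMl ?nm_ge0.
have nz : 1 - w != 0.
  by apply: contraTneq w1 => /eqP; rewrite subr_eq0 => /eqP <-; rewrite nm1 ltxx.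
pose u n := (1 - w) * cexp (\sum_(j < n) w ^+ j / j%:R).
have u1 : u @ \oo --> (1 : C).
  rewrite -(cvg_shiftS u); apply/cvg_nmP => e e0.
  have w1' : `|nm w| < 1 by rewrite ger0_norm ?nm_ge0.
  have /cvgrPdist_lt/(_ e e0) := cvg_geometric (2 * expR (1 - nm w)^-1) w1'.
  apply: filterS => n; rewrite sub0r normrN => h.
  apply: le_lt_trans (log_partial_sum_le n w1) (le_lt_trans _ h).
  by rewrite /geometric /= mulrAC -mulrA ler_norm.
have -> : (fun M => cexp (psum (fun j => - (al ^+ j / j%:R)) M z)) =
  (fun M => (1 - w) * (u M)^-1).
  apply/funext => M; rewrite psumN cexpN /u (invfM (1 - w)) mulrA divff // mul1r.
  congr (cexp _)^-1; apply: eq_bigr => i _; rewrite exprMn; ring.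
have c : (fun M => (1 - w) * (u M)^-1) @ \oo --> (1 - w) * 1^-1.
  apply: cvgM; first exact: cvg_cst.
  exact: (cvgV (oner_neq0 C) u1).
move: c; rewrite invr1 mulr1. exact.
Qed.

(** The effect on coefficients of the substitution z -> z^k. *)
Definition dilate k a m : C := if (k %| m)%N then a (m %/ k)%N else 0.

Lemma psum_dilate k a M z : (0 < k)%N ->
  psum (dilate k a) M.+1 z = psum a (M %/ k).+1 (z ^+ k).
Proof.
move=> k0; elim: M => [|M ih].
  by rewrite /psum div0n !big_ord1 /dilate dvdn0 div0n.
have psumS b N w : psum b N.+1 w = psum b N w + b N * w ^+ N.
  by rewrite /psum big_ord_recr.
rewrite psumS ih divnS // /dilate.
case: ifP => [kM|]; last by rewrite mul0r addr0.
have e : (M.+1 %/ k = (M %/ k).+1)%N by rewrite divnS // kM.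
by rewrite add1n [RHS]psumS -e -exprM mulnC divnK.
Qed.

(** The partial sums are those of [a] at z^k, read along the index M / k + 1, which tends to
    infinity with M. *)
Lemma explim_dilate k a F : (0 < k)%N -> explim a F ->
  explim (dilate k a) (fun z => F (z ^+ k)).
Proof.
move=> k0 h z /diskE z1.
rewrite -(cvg_shiftS (fun M => cexp (psum (dilate k a) M z))) /=.
under eq_fun do rewrite psum_dilate //.
have zk : disk (z ^+ k) by apply/diskE; rewrite nmX exprn_ilt1 ?nm_ge0 // -lt0n.
have c : (fun M => (M %/ k).+1) @ \oo --> \oo.
  apply/cvgnyPge => A; near=> M; rewrite (@leq_trans (M %/ k)%N) // leq_divRL //.
  near: M; exact: nbhs_infty_ge.
exact: (cvg_comp _ _ c (h _ zk)).
Unshelve. all: by end_near. Qed.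

End ExpPowerSeries.

(** * Power series of the Herglotz integral *)

Section OuterExpansion.
Variable R : realType.
Local Notation C := R[i].
Local Notation nm := (@ComplexField.Normc.normc R).
Local Notation circ := `[0%R, (2 * pi)%R]%classic.
Local Notation mu := (@lebesgue_measure R).

Lemma cexp_cvg (T : Type) (F : set_system T) (FF : Filter F) (v : T -> C) (l : C) :
  v @ F --> l -> (fun t => cexp (v t)) @ F --> cexp l.
Proof.
move=> /cvg_nmP vl; apply/cvg_nmP => e e0.
have K0 : 0 < 2 * expR 1 * nm (cexp l).
  by rewrite nm_cexp !mulr_gt0 ?expR_gt0.
have m0 : 0 < Num.min 1 (e / (2 * expR 1 * nm (cexp l))).
  by rewrite lt_min ltr01 divr_gt0.
apply: filterS (vl _ m0) => t; rewrite lt_min => /andP[v1 ve].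
have -> : cexp (v t) - cexp l = cexp l * (cexp (v t - l) - 1).
  by rewrite mulrBr mulr1 -cexpD addrCA subrr addr0.
move: ve; rewrite ltr_pdivlMr // nmM => ve.
have := nm_cexpB1 (v t - l); set d := nm _ in v1 ve *; set q := nm _ => h.
have d0 : 0 <= d := nm_ge0 _.
have : q * nm (cexp l) <= 2 * (d * expR 1) * nm (cexp l).
  rewrite ler_wpM2r ?nm_ge0 // (le_trans h) // ler_wpM2l // ler_wpM2l // ler_expR.
  exact: ltW.
move=> h2; rewrite mulrC (le_lt_trans h2) //.
by rewrite (_ : _ * _ = d * (2 * expR 1 * nm (cexp l))) //; ring.
Qed.

(** A class of kernels, closed under sums and products, that stay integrable when multiplied by the
    integrable function [u]. *)
Definition bdm (B : R) (h : R -> C) :=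
  [/\ measurable_fun circ (fun t => complex.Re (h t)),
      measurable_fun circ (fun t => complex.Im (h t)) &
      forall t, nm (h t) <= B].

Lemma bdm_cst w : bdm (nm w) (fun=> w).
Proof. by split. Qed.

Lemma bdmD A B g h : bdm A g -> bdm B h -> bdm (A + B) (fun t => g t + h t).
Proof.
move=> [g1 g2 gA] [h1 h2 hB]; split => [||t].
- rewrite (_ : (fun _ => _) = (fun t => complex.Re (g t)) \+ (fun t => complex.Re (h t))).
    exact: measurable_funD.
  by apply/funext => t /=; case: (g t) (h t) => ? ? [].
- rewrite (_ : (fun _ => _) = (fun t => complex.Im (g t)) \+ (fun t => complex.Im (h t))).
    exact: measurable_funD.
  by apply/funext => t /=; case: (g t) (h t) => ? ? [].
- by rewrite (le_trans (nmD _ _)) // lerD.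
Qed.

Lemma bdmM A B g h : bdm A g -> bdm B h -> bdm (A * B) (fun t => g t * h t).
Proof.
move=> [g1 g2 gA] [h1 h2 hB]; split => [||t].
- rewrite (_ : (fun _ => _) =
    ((fun t => complex.Re (g t)) \* (fun t => complex.Re (h t))) \-
    ((fun t => complex.Im (g t)) \* (fun t => complex.Im (h t)))).
    by apply: measurable_funB; exact: measurable_funM.
  by apply/funext => t /=; case: (g t) (h t) => ? ? [].
- rewrite (_ : (fun _ => _) =
    ((fun t => complex.Re (g t)) \* (fun t => complex.Im (h t))) \+
    ((fun t => complex.Im (g t)) \* (fun t => complex.Re (h t)))).
    by apply: measurable_funD; exact: measurable_funM.
  by apply/funext => t /=; case: (g t) (h t) => ? ? [].
- by rewrite nmM ler_pM ?nm_ge0.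
Qed.

Definition fourier_exp (m : nat) (t : R) : C := expi (- t) ^+ m.

Lemma bdm_fourier_exp m : bdm 1 (fourier_exp m).
Proof.
elim: m => [|m ih].
  by have := bdm_cst 1; rewrite nm1; congr bdm; apply/funext => t; rewrite /fourier_exp expr0.
rewrite -[1]mulr1 (_ : fourier_exp _ = fun t => expi (- t) * fourier_exp m t); last first.
  by apply/funext => t; rewrite /fourier_exp exprS.
apply: bdmM ih; split=> [||t]; last by rewrite nm_expi.
- apply: measurable_funTS; apply: continuous_measurable_fun => t /=.
  apply: continuous_comp; [exact: opp_continuous | exact: continuous_cos].
- apply: measurable_funTS; apply: continuous_measurable_fun => t /=.
  apply: continuous_comp; [exact: opp_continuous | exact: continuous_sin].
Qed.

Variable u : R -> R.
Hypothesis iu : mu.-integrable circ (EFin \o u).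

(* Componentwise integral of h u over the circle, without the factor 1 / (2 pi). *)
Definition cint (h : R -> C) : C :=
  (\int[mu]_(t in circ) (complex.Re (h t) * u t)) +i*
  (\int[mu]_(t in circ) (complex.Im (h t) * u t)).

Definition l1norm : R := \int[mu]_(t in circ) `|u t|.

Lemma bdm_integrable (p : R -> R) B : measurable_fun circ p -> (forall t, `|p t| <= B) ->
  mu.-integrable circ (EFin \o (fun t => p t * u t)).
Proof.
move=> mp pB.
have iBu : mu.-integrable circ (EFin \o (fun t => B * u t)).
  rewrite (_ : _ \o _ = (fun t => B%:E * (EFin \o u) t)%E); first exact: integrableZl.
  by apply/funext => t /=; rewrite EFinM.
apply: le_integrable iBu => //.
  apply/measurable_EFinP/measurable_funM => //.
  by apply/measurable_EFinP; case/integrableP: iu.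
move=> t _ /=; rewrite lee_fin !normrM ler_wpM2r //.
by rewrite (le_trans (pB t)) ?ler_norm.
Qed.

Lemma bdm_integral_le (p : R -> R) B : measurable_fun circ p -> (forall t, `|p t| <= B) ->
  `|\int[mu]_(t in circ) (p t * u t)| <= B * l1norm.
Proof.
move=> mp pB; have ip := bdm_integrable mp pB.
have iau : mu.-integrable circ (EFin \o (fun t => `|u t|)).
  by have := integrable_abse iu.
rewrite (le_trans (le_normr_Rintegral _ ip)) // /l1norm -RintegralZl //.
apply: le_Rintegral => //.
- by have := integrable_abse ip.
- rewrite (_ : _ \o _ = (fun t => B%:E * (EFin \o (fun t => `|u t|)%R) t)%E).
    exact: integrableZl.
  by apply/funext => t /=; rewrite EFinM.
- by move=> t _; rewrite normrM ler_wpM2r.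
Qed.

Lemma cint_le B h : bdm B h -> nm (cint h) <= 2 * B * l1norm.
Proof.
move=> [h1 h2 hB]; rewrite (le_trans (nm_le_ReIm _)) //=.
have -> : 2 * B * l1norm = B * l1norm + B * l1norm by ring.
apply: lerD; apply: bdm_integral_le => // t; rewrite (le_trans _ (hB t)) //.
  exact: Re_le_nm.
exact: Im_le_nm.
Qed.

Lemma cintD A B g h : bdm A g -> bdm B h -> cint (fun t => g t + h t) = cint g + cint h.
Proof.
move=> [g1 g2 gA] [h1 h2 hB].
have gR t : `|complex.Re (g t)| <= A by rewrite (le_trans _ (gA t)) ?Re_le_nm.
have gI t : `|complex.Im (g t)| <= A by rewrite (le_trans _ (gA t)) ?Im_le_nm.
have hR t : `|complex.Re (h t)| <= B by rewrite (le_trans _ (hB t)) ?Re_le_nm.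
have hI t : `|complex.Im (h t)| <= B by rewrite (le_trans _ (hB t)) ?Im_le_nm.
rewrite /cint; congr Complex.
- rewrite -RintegralD //; [|exact: bdm_integrable gR|exact: bdm_integrable hR].
  by apply: eq_Rintegral => t _; case: (g t) (h t) => ? ? [? ?] /=; rewrite mulrDl.
- rewrite -RintegralD //; [|exact: bdm_integrable gI|exact: bdm_integrable hI].
  by apply: eq_Rintegral => t _; case: (g t) (h t) => ? ? [? ?] /=; rewrite mulrDl.
Qed.

Lemma cintM A h (w : C) : bdm A h -> cint (fun t => h t * w) = cint h * w.
Proof.
case: w => a b [h1 h2 hA].
have hR t : `|complex.Re (h t)| <= A by rewrite (le_trans _ (hA t)) ?Re_le_nm.
have hI t : `|complex.Im (h t)| <= A by rewrite (le_trans _ (hA t)) ?Im_le_nm.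
have iR := bdm_integrable h1 hR; have iI := bdm_integrable h2 hI.
have iZ (p : R -> R) (s : R) : mu.-integrable circ (EFin \o p) ->
    mu.-integrable circ (EFin \o (fun t => p t * s)).
  move=> ip; rewrite (_ : _ \o _ = (fun t => (EFin \o p) t * s%:E)%E); first exact: integrableZr.
  by apply/funext => t /=; rewrite EFinM.
rewrite /cint; congr Complex => /=.
- rewrite -!RintegralZr // -RintegralB //; [|exact: iZ|exact: iZ].
  by apply: eq_Rintegral => t _; case: (h t) => ? ? /=; ring.
- rewrite -!RintegralZr // -RintegralD //; [|exact: iZ|exact: iZ].
  by apply: eq_Rintegral => t _; case: (h t) => ? ? /=; ring.
Qed.

(* With w = exp(-it) z, the Herglotz kernel is (1 + w) / (1 - w) = -1 + 2 / (1 - w). *)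
Definition herglotz_partial (M : nat) (z : C) (t : R) : C :=
  -1 + \sum_(m < M) fourier_exp m t * (2 * z ^+ m).

(** The remainder of the geometric series is exactly 2 w^M / (1 - w), and |1 - w| >= 1 - |z|. The
    bound is independent of t, so it can be integrated. *)
Lemma herglotz_tail_le M (t : R) (z : C) : nm z < 1 ->
  nm (herglotz t z - herglotz_partial M z t) <= 2 * nm z ^+ M * (1 - nm z)^-1.
Proof.
move=> z1; set w := expi (- t) * z.
have wz : nm w = nm z by rewrite nmM nm_expi mul1r.
have ee : expi t * expi (- t) = 1 :> C.
  rewrite /expi cosN sinN; apply/eqP; rewrite eq_complex /=; apply/andP; split; apply/eqP.
    by rewrite mulrN opprK -!expr2 cos2Dsin2.
  by rewrite mulrN mulrC addNr.
have e0 : expi t != 0 :> C by rewrite -nm_eq0 nm_expi oner_neq0.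
have w1 : 1 - nm z <= nm (1 - w).
  by rewrite lerBlDr -{1}nm1 -{1}[1](subrK w) (le_trans (nmD _ _)) // wz.
have z1' : 0 < 1 - nm z by rewrite subr_gt0.
have w0 : 1 - w != 0 by rewrite -nm_eq0 gt_eqF // (lt_le_trans z1').
have hw : herglotz t z = (1 + w) / (1 - w).
  have -> : herglotz t z = (expi t * (1 + w)) / (expi t * (1 - w)).
    by rewrite /herglotz mulrDr mulrBr mulr1 mulrA ee mul1r.
  by rewrite invfM mulrACA divff // mul1r.
have pw : herglotz_partial M z t = -1 + 2 * ((1 - w ^+ M) / (1 - w)).
  rewrite /herglotz_partial; congr (_ + _).
  have -> : 1 - w ^+ M = (1 - w) * \sum_(m < M) w ^+ m.
    by rewrite -opprB subrX1 -mulNr opprB.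
  rewrite [(1 - w) * _]mulrC mulfK // mulr_sumr; apply: eq_bigr => m _.
  by rewrite /fourier_exp /w exprMn; ring.
have -> : herglotz t z - herglotz_partial M z t = 2 * (w ^+ M) * (1 - w)^-1.
  by rewrite hw pw; field.
rewrite !nmM nmV nmX nm_nat wz ler_wpM2l ?mulr_ge0 ?exprn_ge0 ?nm_ge0 //.
by rewrite lef_pV2 // posrE // (lt_le_trans z1').
Qed.

Lemma bdm_herglotz_partial M z : exists B, bdm B (herglotz_partial M z).
Proof.
rewrite /herglotz_partial; elim: M => [|M [B ih]].
  exists (nm (-1)); under eq_fun do rewrite big_ord0 addr0.
  exact: bdm_cst.
exists (B + 1 * nm (2 * z ^+ M)); under eq_fun do rewrite big_ord_recr /= addrA.
by apply: bdmD ih _; apply: bdmM (bdm_fourier_exp M) (bdm_cst _).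
Qed.

Lemma herglotz_partial_cvg (t : R) z : nm z < 1 ->
  (fun M => herglotz_partial M z t) @ \oo --> herglotz t z.
Proof.
move=> z1; apply/cvg_nmP => e e0.
have z1' : `|nm z| < 1 by rewrite ger0_norm ?nm_ge0.
have /cvgrPdist_lt/(_ e e0) := cvg_geometric (2 * (1 - nm z)^-1) z1'.
apply: filterS => M; rewrite sub0r normrN => h.
rewrite -nmN opprB (le_lt_trans (herglotz_tail_le M t z1)) // (le_lt_trans _ h) //.
by rewrite /geometric /= mulrAC ler_norm.
Qed.

Lemma cvg_Re (T : Type) (F : set_system T) (FF : Filter F) (v : T -> C) (l : C) :
  v @ F --> l -> (fun t => complex.Re (v t)) @ F --> complex.Re l.
Proof.
move=> /cvg_nmP vl; apply/cvgrPdist_lt => e /vl.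
apply: filterS => t; apply: le_lt_trans; rewrite -normrN opprB.
by rewrite (le_trans _ (Re_le_nm _)) //; case: (v t) (l) => ? ? [? ?].
Qed.

Lemma cvg_Im (T : Type) (F : set_system T) (FF : Filter F) (v : T -> C) (l : C) :
  v @ F --> l -> (fun t => complex.Im (v t)) @ F --> complex.Im l.
Proof.
move=> /cvg_nmP vl; apply/cvgrPdist_lt => e /vl.
apply: filterS => t; apply: le_lt_trans; rewrite -normrN opprB.
by rewrite (le_trans _ (Im_le_nm _)) //; case: (v t) (l) => ? ? [? ?].
Qed.

(** Measurability passes to the pointwise limit of the partial sums; the bound is the tail estimate
    at M = 0, where the partial sum is -1. *)
Lemma bdm_herglotz z : nm z < 1 -> bdm (2 * (1 - nm z)^-1 + 1) (fun t => herglotz t z).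
Proof.
move=> z1; split => [||t].
- apply: (measurable_fun_cvg (h := fun M t => complex.Re (herglotz_partial M z t))) => [M|t _].
    by have [B []] := bdm_herglotz_partial M z.
  by apply: cvg_Re; exact: herglotz_partial_cvg.
- apply: (measurable_fun_cvg (h := fun M t => complex.Im (herglotz_partial M z t))) => [M|t _].
    by have [B []] := bdm_herglotz_partial M z.
  by apply: cvg_Im; exact: herglotz_partial_cvg.
- have := herglotz_tail_le 0 t z1.
  rewrite /herglotz_partial big_ord0 addr0 opprK expr0 mulr1 => h.
  rewrite -[herglotz t z](addrK 1) (le_trans (nmB _ _)) // nm1 lerD2r.
  exact: h.
Qed.

Lemma cint_herglotz_partial M z : cint (herglotz_partial M z) =
  - cint (fun=> 1) + \sum_(m < M) cint (fourier_exp m) * (2 * z ^+ m).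
Proof.
elim: M => [|M ih].
  rewrite big_ord0 addr0 -[RHS]mulrN1 -(cintM (-1) (bdm_cst 1)); congr cint.
  by apply/funext => t; rewrite /herglotz_partial big_ord0 addr0 mul1r.
have [B hB] := bdm_herglotz_partial M z.
rewrite big_ord_recr /= addrA -ih -(cintM (2 * z ^+ M) (bdm_fourier_exp M)).
rewrite -(cintD hB (bdmM (bdm_fourier_exp M) (bdm_cst (2 * z ^+ M)))); congr cint.
by apply/funext => t; rewrite /herglotz_partial big_ord_recr /= addrA.
Qed.

Lemma cint_tail_le M z : nm z < 1 ->
  nm (cint (fun t => herglotz t z) - cint (herglotz_partial M z)) <=
  2 * (2 * nm z ^+ M * (1 - nm z)^-1) * l1norm.
Proof.
move=> z1; have [B hB] := bdm_herglotz_partial M z.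
have hN : bdm (B * nm (-1)) (fun t => herglotz_partial M z t * -1).
  exact: bdmM hB (bdm_cst _).
rewrite -[- cint _]mulrN1 -(cintM (-1) hB) -(cintD (bdm_herglotz z1) hN).
have [h1 h2 _] := bdmD (bdm_herglotz z1) hN.
apply: cint_le; split=> // t; rewrite mulrN1; exact: herglotz_tail_le.
Qed.

Lemma herglotz_intE z : herglotz_int u z = cint (fun t => herglotz t z) * ((2 * pi)^-1)%:C.
Proof. by rewrite /herglotz_int /cint; simpc. Qed.

(** For m >= 1, twice the m-th Fourier coefficient of [u]. Index 0 gets 0 because the value of the
    Herglotz integral at the origin is split off. *)
Definition herglotz_coef (m : nat) : C :=
  if m is 0%N then 0 else 2 * cint (fourier_exp m) * ((2 * pi)^-1)%:C.

Lemma herglotz_coef_le : exists A : R, forall m, nm (herglotz_coef m) <= A.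
Proof.
have p0 : 0 <= ((2 * pi)^-1 : R) by rewrite invr_ge0 mulr_ge0 ?pi_ge0.
have l0 : 0 <= l1norm by apply: Rintegral_ge0.
exists (2 * (2 * 1 * l1norm) * (2 * pi)^-1) => -[|m].
  by rewrite /herglotz_coef nm0 !mulr_ge0.
rewrite /herglotz_coef.
rewrite !nmM nm_real nm_nat ger0_norm // ler_wpM2r // ler_wpM2l //.
exact: cint_le (bdm_fourier_exp _).
Qed.

(** The kernel at z = 0 is constantly 1. What matters is that the value is real: its exponential is
    then positive and equals |f(0)|. *)
Lemma herglotz0 : cint (fun t => herglotz t (0 : C)) = (\int[mu]_(t in circ) u t)%:C.
Proof.
have -> : (fun t => herglotz t (0 : C)) = fun=> 1.
  apply/funext => t; rewrite /herglotz addr0 subr0 divff //.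
  by rewrite -nm_eq0 nm_expi oner_neq0.
rewrite /cint /=; congr Complex.
  by apply: eq_Rintegral => t _; rewrite mul1r.
rewrite (_ : (fun t => 0 * u t) = fun=> 0) ?Rintegral_cst ?mul0r //.
by apply/funext => t; rewrite mul0r.
Qed.

Lemma explim_herglotz :
  explim herglotz_coef (fun z => cexp (herglotz_int u z - herglotz_int u 0)).
Proof.
move=> z /diskE z1; apply: cexp_cvg; rewrite -(cvg_shiftS (fun M => psum herglotz_coef M z)).
apply/cvg_nmP => e e0.
have z1' : `|nm z| < 1 by rewrite ger0_norm ?nm_ge0.
(* The bound of [cint_tail_le] at M + 1 with |z|^M taken out, times the factor 1 / (2 pi). *)
set K := 4 * nm z * (1 - nm z)^-1 * l1norm * `|(2 * pi)^-1|.
have /cvgrPdist_lt/(_ e e0) := cvg_geometric K z1'.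
apply: filterS => M; rewrite sub0r normrN => h.
(* The constant term of the expanded kernel is -1 + 2 = 1, the kernel at 0, so it cancels against
   [herglotz_int u 0]. *)
have -> : psum herglotz_coef M.+1 z - (herglotz_int u z - herglotz_int u 0) =
  - (cint (fun t => herglotz t z) - cint (herglotz_partial M.+1 z)) * ((2 * pi)^-1)%:C.
  have h1 : cint (fun t => herglotz t (0 : C)) = cint (fun=> 1).
    congr cint; apply/funext => t; rewrite /herglotz addr0 subr0 divff //.
    by rewrite -nm_eq0 nm_expi oner_neq0.
  rewrite !herglotz_intE h1 cint_herglotz_partial /psum !big_ord_recl /= mul0r add0r expr0.
  have -> : fourier_exp 0 = fun=> 1 by apply/funext => t; rewrite /fourier_exp expr0.
  have -> : \sum_(i < M) 2 * cint (fourier_exp (lift ord0 i)) * ((2 * pi)^-1)%:C * z ^+ bump 0 i =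
    \sum_(i < M) cint (fourier_exp (bump 0 i)) * (2 * z ^+ bump 0 i) * ((2 * pi)^-1)%:C.
    by apply: eq_bigr => i _; rewrite /=; ring.
  by rewrite -mulr_suml; ring.
rewrite nmM nmN nm_real (le_lt_trans _ h) //.
rewrite (le_trans (ler_wpM2r (normr_ge0 _) (cint_tail_le M.+1 z1))) // (le_trans _ (ler_norm _)) //.
by rewrite /geometric /= /K exprS le_eqVlt; apply/orP; left; apply/eqP; ring.
Qed.

End OuterExpansion.

(** * Expansion of an outer function *)

Section OuterFactor.
Variable R : realType.
Local Notation C := R[i].
Local Notation nm := (@ComplexField.Normc.normc R).

(** [c] is the constant in the definition of [outer]. Since the exponent at 0 is real, its
    exponential is |f(0)|, and dividing it out leaves the series without constant term. *)
Lemma outer_power_series (f : C -> C) : outer f ->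
  exists (c : C) (a : nat -> C) (A : R) (G : C -> C),
    [/\ nm c = 1, a 0%N = 0, forall m, nm (a m) <= A, explim a G &
        forall z, disk z -> f z = `|f 0| * c * G z].
Proof.
move=> [c [k [c1 [k0 [_ [ik fE]]]]]].
have [A hA] := herglotz_coef_le ik.
exists c, (herglotz_coef (fun t => ln (k t))), A,
  (fun z => cexp (herglotz_int (fun t => ln (k t)) z - herglotz_int (fun t => ln (k t)) 0)).
split => //.
- by apply: complexI; rewrite -normE c1 rmorph1.
- exact: (explim_herglotz ik).
move=> z zD; rewrite !fE //; last by rewrite /disk /= normr0.
rewrite normrM c1 mul1r.
have -> : `|cexp (herglotz_int (fun t => ln (k t)) 0)| = cexp (herglotz_int (fun t => ln (k t)) 0).
  rewrite herglotz_intE herglotz0 -rmorphM normE nm_cexp /cexp /expi /= cos0 sin0.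
  by rewrite -/(1%:C) rmorph1 mulr1.
by rewrite mulrAC -cexpD addrC subrK mulrC.
Qed.

End OuterFactor.

(** * Inner functions and the logarithms of the factors built from them *)

Section InnerPairs.
Variable R : realType.
Local Notation C := R[i].
Local Notation nm := (@ComplexField.Normc.normc R).
Implicit Types (z w : C) (p q : C -> C).

Definition cayley_pair (p q : C) : C :=
  ((1 - 'i%R * p) / (1 + 'i%R * p)) * ((1 + 'i%R * q) / (1 - 'i%R * q)).

Lemma nm_im : nm 'i%R = 1.
Proof. by apply: complexI; rewrite -normE normCi rmorph1. Qed.

(** Reduces differentiability to an algebraic factorisation of the increment by w - z with a
    continuous cofactor. *)
Lemma dnbhs_quotient_cvg p (g : C -> C) z : g @ z --> g z ->
  (\forall w \near z, p w - p z = (w - z) * g w) ->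
  (fun w => (p w - p z) / (w - z)) @ z^' --> g z.
Proof.
move=> /cvg_nmP gz pE; apply/cvg_nmP => e /gz ge.
rewrite /dnbhs near_withinE; near=> w => wz; have -> : p w - p z = (w - z) * g w by near: w.
rewrite mulrAC divff ?subr_eq0 // mul1r; near: w; exact: ge.
Unshelve. all: by end_near. Qed.

Lemma radius_cvg (t : R) :
  (fun r : R => r%:C * expi t) @ (1%R)^'- --> expi t.
Proof.
apply: cvg_at_left_filter; apply/cvg_nmP => e e0.
near=> r; rewrite -{2}[expi t]mul1r -mulrBl nmM nm_expi mulr1.
rewrite -(rmorph1 (real_complex R)) -rmorphB nm_real distrC; near: r.
by move: e e0; apply/cvgrPdist_lt; exact: cvg_id.
Unshelve. all: by end_near. Qed.

Lemma ae_circleT (P : R -> Prop) : (forall t, P t) -> ae_circle P.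
Proof. by move=> h; apply: aeW => t _; exact: h. Qed.

Lemma cvgX (n : nat) (T : Type) (F : set_system T) {FF : Filter F} (u : T -> C) (l : C) :
  u @ F --> l -> (fun t => u t ^+ n) @ F --> l ^+ n.
Proof.
move=> ul; elim: n => [|n ih].
  by rewrite expr0; under eq_fun do rewrite expr0; exact: cvg_cst.
rewrite exprS; under eq_fun do rewrite exprS.
exact: cvgM ul ih.
Qed.

Lemma cvg_csum (n : nat) (T : Type) (F : set_system T) {FF : Filter F}
    (u : nat -> T -> C) (l : nat -> C) :
  (forall i, u i @ F --> l i) ->
  (fun t => \sum_(i < n) u i t) @ F --> \sum_(i < n) l i.
Proof.
move=> ul; elim: n => [|n ih].
  by rewrite big_ord0; under eq_fun do rewrite big_ord0; exact: cvg_cst.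
rewrite big_ord_recr /=; under eq_fun do rewrite big_ord_recr /=.
exact: (@cvgD C C^o _ _ _ _ _ _ _ ih (ul n)).
Qed.

Lemma inner_monomial (ze : C) k : nm ze = 1 -> inner (fun z => ze * z ^+ k).
Proof.
move=> ze1; split; last first.
  apply: ae_circleT => t; exists (ze * expi t ^+ k); split.
    rewrite /radlim; apply: cvgM; [exact: cvg_cst | exact: (@cvgX k _ _ _ _ _ (@radius_cvg t))].
  by rewrite normE nmM nmX nm_expi expr1n mulr1 ze1.
split; last first.
  exists 1 => z /diskE z1; rewrite normE lecR nmM ze1 mul1r nmX.
  by rewrite exprn_ile1 ?nm_ge0 ?ltW.
(* The cofactor comes from the factorisation of w^k - z^k. *)
move=> z _; pose g w := ze * \sum_(i < k) w ^+ (k.-1 - i) * z ^+ i.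
have h : (fun w => \sum_(i < k) w ^+ (k.-1 - i) * z ^+ i) @ z -->
    \sum_(i < k) z ^+ (k.-1 - i) * z ^+ i.
  have cid : (fun w : C => w) @ z --> z by exact: cvg_id.
  have hi i : (fun w => w ^+ (k.-1 - i) * z ^+ i) @ z --> z ^+ (k.-1 - i) * z ^+ i.
    have hX : (fun w : C => w ^+ (k.-1 - i)) @ z --> z ^+ (k.-1 - i).
      exact: (@cvgX (k.-1 - i) C (nbhs z) _ (fun w => w) z cid).
    exact: cvgM hX (cvg_cst (z ^+ i)).
  exact: (@cvg_csum k C (nbhs z) _ (fun i w => w ^+ (k.-1 - i) * z ^+ i) _ hi).
exists (g z); apply: dnbhs_quotient_cvg; first exact: cvgM (cvg_cst ze) h.
near=> w; rewrite -mulrBr subrXX /g; ring.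
Unshelve. all: by end_near. Qed.

Lemma inner_mobius (s : R) : `|s| < 1 ->
  inner (fun z => (s%:C + z) / (1 + s%:C * z)).
Proof.
move=> s1.
have d0 z : nm z <= 1 -> 1 + s%:C * z != 0.
  move=> z1; apply/negP => /eqP h.
  have : nm (s%:C * z) < 1 by rewrite nmM nm_real (le_lt_trans _ s1) // ler_piMr.
  have -> : s%:C * z = - 1 by apply/eqP; rewrite -addr_eq0 addrC h.
  by rewrite nmN nm1 ltxx.
have cden z : (fun w => 1 + s%:C * w) @ z --> 1 + s%:C * z.
  have cid : (fun w : C => w) @ z --> z by exact: cvg_id.
  have h : (fun w => s%:C * w) @ z --> s%:C * z by exact: cvgM (cvg_cst _) cid.
  exact: (@cvgD C C^o _ _ _ _ _ _ _ (cvg_cst (1 : C)) h).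
split; last first.
  apply: ae_circleT => t; exists ((s%:C + expi t) / (1 + s%:C * expi t)); split.
    have hr := @radius_cvg t.
    have hn : (fun r : R => s%:C + r%:C * expi t) @ (1%R)^'- --> s%:C + expi t.
      exact: (@cvgD C C^o _ _ _ _ _ _ _ (cvg_cst s%:C) hr).
    have hs : (fun r : R => s%:C * (r%:C * expi t)) @ (1%R)^'- --> s%:C * expi t.
      by apply: cvgM; [exact: cvg_cst | exact: hr].
    have hd : (fun r : R => 1 + s%:C * (r%:C * expi t)) @ (1%R)^'- --> 1 + s%:C * expi t.
      exact: (@cvgD C C^o _ _ _ _ _ _ _ (cvg_cst (1 : C)) hs).
    have d1 : 1 + s%:C * expi t != 0 by rewrite d0 // nm_expi.
    by rewrite /radlim; apply: cvgM; [exact: hn | exact: (cvgV d1 hd)].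
  rewrite normE nmM nmV; congr (_%:C).
  have n0 : nm (1 + s%:C * expi t) != 0 by rewrite nm_eq0 d0 // nm_expi.
  rewrite (_ : nm (s%:C + expi t) = nm (1 + s%:C * expi t)) ?divff //.
  rewrite /=; congr Num.sqrt.
  have := cos2Dsin2 t; set x := cos t; set y := sin t => xy.
  (* |s + w|^2 - |1 + s w|^2 = (s^2 - 1)(1 - |w|^2) vanishes on the circle; the same identity gives
     the bound 1 inside the disk. *)
  apply/eqP; rewrite -subr_eq0 (_ : _ - _ = (s ^+ 2 - 1) * (1 - (x ^+ 2 + y ^+ 2))); last by ring.
  by rewrite xy subrr mulr0.
split; last first.
  exists 1 => z /diskE z1; rewrite normE lecR nmM nmV ler_pdivrMr ?mul1r.
    case: z z1 => a b; rewrite /= => z1; apply: ler_wsqrtr.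
    have z2 : a ^+ 2 + b ^+ 2 < 1.
      have ab0 : 0 <= a ^+ 2 + b ^+ 2 by rewrite addr_ge0 ?sqr_ge0.
      by rewrite -(sqr_sqrtr ab0) exprn_ilt1 ?sqrtr_ge0.
    have s2 : s ^+ 2 < 1 by rewrite -[ltLHS]ger0_norm ?sqr_ge0 // normrX exprn_ilt1.
    rewrite -subr_ge0 (_ : _ - _ = (1 - s ^+ 2) * (1 - (a ^+ 2 + b ^+ 2))); last by ring.
    by rewrite mulr_ge0 // subr_ge0 ltW.
  by rewrite lt_neqAle nm_ge0 eq_sym nm_eq0 d0 // ltW.
(* Bringing the two Moebius values to a common denominator leaves the numerator (1 - s^2)(w - z). *)
move=> z /diskE z1; pose g w := (1 - s%:C ^+ 2) / ((1 + s%:C * w) * (1 + s%:C * z)).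
have dz := d0 z (ltW z1).
exists (g z); apply: dnbhs_quotient_cvg.
  have hM : (fun w => (1 + s%:C * w) * (1 + s%:C * z)) @ z --> (1 + s%:C * z) * (1 + s%:C * z).
    exact: cvgM (cden z) (cvg_cst _).
  have hV : (fun w => ((1 + s%:C * w) * (1 + s%:C * z))^-1) @ z -->
      ((1 + s%:C * z) * (1 + s%:C * z))^-1.
    exact: cvgV (mulf_neq0 dz dz) hM.
  exact: cvgM (cvg_cst _) hV.
have /cvg_nmP/(_ 1 ltr01) : (fun w => w) @ z --> z by exact: cvg_id.
(* For w near z the denominator at w differs from the one at z by less than the latter's modulus,
   hence is nonzero. *)
have /cvg_nmP := cden z => /(_ (nm (1 + s%:C * z))).
rewrite lt_neqAle eq_sym nm_eq0 dz nm_ge0 => /(_ erefl) + _.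
apply: filterS => w h.
have dw : 1 + s%:C * w != 0.
  by apply: contraTneq h => ->; rewrite sub0r nmN ltxx.
by rewrite /g; field; rewrite dz dw.
Qed.

(** Coefficients of -log(1 - al z); at j = 0 the convention that the inverse of 0 is 0 gives the
    correct value 0. *)
Definition log_coef (al : C) (j : nat) : C := al ^+ j / j%:R.

Lemma log_coef_le (al : C) j : nm al <= 1 -> nm (log_coef al j) <= 1.
Proof.
move=> al1; rewrite nmM nmV nm_nat nmX; case: j => [|j]; first by rewrite invr0 mulr0.
by rewrite -[leRHS]mulr1 ler_pM ?exprn_ge0 ?nm_ge0 ?exprn_ile1 ?nm_ge0 // invf_le1 ?ltr0n // ler1n.
Qed.

Lemma log_coef0 (al : C) : log_coef al 0 = 0.
Proof. by rewrite /log_coef invr0 mulr0. Qed.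

Lemma one_sub_neq0 (al z : C) : nm al <= 1 -> disk z -> 1 - al * z != 0.
Proof.
move=> al1 /diskE z1; rewrite subr_eq0; apply: contraTneq z1 => e.
rewrite -leNgt -nm1 e nmM ler_piMl ?nm_ge0 //.
Qed.

Lemma explim_one_subV (al : C) : nm al <= 1 ->
  explim (log_coef al) (fun z => (1 - al * z)^-1).
Proof.
move=> al1.
have h := explimN (explim_one_sub al1) (fun z => one_sub_neq0 al1).
by apply: explim_eq h _ _ => [j|z _ //]; rewrite opprK.
Qed.

(** The two square roots are opposite, and they are purely imaginary only for c = -1; otherwise one
    of them has positive real part. *)
Lemma unimodular_sqrt (c : C) : nm c = 1 -> c != -1 ->
  exists x y : R, [/\ 0 < x, x ^+ 2 + y ^+ 2 = 1 & (x +i* y) ^+ 2 = c].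
Proof.
move=> c1 cN1; case E : (sqrtc c) => [x y].
have sq : (x +i* y) ^+ 2 = c by rewrite -E sqr_sqrtc.
have n1 : x ^+ 2 + y ^+ 2 = 1.
  have : nm ((x +i* y) ^+ 2) = 1 by rewrite sq.
  by rewrite nmX /= sqr_sqrtr ?addr_ge0 ?sqr_ge0.
have x0 : x != 0.
  apply: contra_neq cN1 => x0; rewrite -sq x0; move: n1; rewrite x0 expr0n add0r => y1.
  by apply/eqP; rewrite eq_complex /= mul0r mulr0 mul0r addr0 sub0r -expr2 y1 !eqxx oppr0 eqxx.
have [xp|xn] := ltP 0 x; first by exists x, y.
exists (- x), (- y); split; first by rewrite oppr_gt0 lt_neqAle x0.
  by rewrite !sqrrN.
by rewrite -sq -[RHS]sqrrN; congr (_ ^+ 2).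
Qed.

(* With c = tau^2, Re tau > 0, take phi^+ = (s + z)/(1 + s z) and
   phi^- = (-s + z)/(1 - s z), s being such that (1 - i s)/(1 + i s) = tau; for
   c = -1 the constants 1 and -1 do. *)
Lemma inner_pair_unimodular (c : C) : nm c = 1 ->
  exists (p q G : C -> C) (b : nat -> C),
    [/\ inner p, inner q, explim b G, b 0%N = 0 /\ forall m, nm (b m) <= 4 &
        forall z, disk z -> cayley_pair (p z) (q z) = c * G z].
Proof.
move=> c1; have [cN1|cN1] := eqVneq c (-1).
  exists (fun z => 1 * z ^+ 0), (fun z => -1 * z ^+ 0), (fun=> 1), (fun=> 0); split.
  - by apply: inner_monomial; rewrite nm1.
  - by apply: inner_monomial; rewrite nmN nm1.
  - exact: explim0.
  - by split=> // m; rewrite nm0.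
  move=> z _; rewrite cN1 !expr0 /cayley_pair !mulr1 mulrN1 opprK.
  have i2 : 'i%R ^+ 2 = -1 :> C := sqrCi _.
  have d0 : 1 + 'i%R != 0 :> C.
    apply/eqP => /(congr1 (fun z => z * (1 - 'i%R))); rewrite mul0r.
    have -> : (1 + 'i%R) * (1 - 'i%R) = 1 - 'i%R ^+ 2 :> C by ring.
    by rewrite i2 opprK -mulr2n => /eqP; rewrite pnatr_eq0.
  (* Both quotients of the pair equal -i, and (-i)^2 = -1. *)
  have -> : (1 - 'i%R) / (1 + 'i%R) = - 'i%R :> C.
    apply: (mulIf d0); rewrite divfK //.
    have -> : - 'i%R * (1 + 'i%R) = - 'i%R - 'i%R ^+ 2 :> C by ring.
    by rewrite i2 opprK addrC.
  by rewrite mulrNN -expr2 i2.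
have [x [y [x0 xy1 ce]]] := unimodular_sqrt c1 cN1.
(* For tau = x + i y = exp(i theta) this is -tan(theta / 2); x > 0 puts theta / 2 strictly between
   -pi/4 and pi/4, so |s| < 1. *)
pose s := - y / (1 + x).
have x1 : 0 < 1 + x by rewrite addr_gt0.
have s1 : `|s| < 1.
  rewrite /s mulNr normrN normrM normfV (gtr0_norm x1) ltr_pdivrMr // mul1r.
  rewrite -(@ltr_pXn2r _ 2) ?nnegrE ?(ltW x1) // real_normK ?num_real //; nra.
pose ta : C := x +i* y; pose tb : C := x -i* y.
have tab : ta * tb = 1.
  apply/eqP; rewrite eq_complex /=; apply/andP; split; apply/eqP; last by ring.
  by rewrite -xy1; ring.
have nta : nm ta = 1 by rewrite /= xy1 sqrtr1.
have ntb : nm tb = 1 by rewrite /= sqrrN xy1 sqrtr1.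
have nNs : `|- s| < 1 by rewrite normrN.
have i2 : 'i%R ^+ 2 = -1 :> C := sqrCi _.
set I : C := 'i%R in i2 *.
have nI : nm I = 1 := nm_im.
have hs : 1 - I * s%:C = ta * (1 + I * s%:C).
  have x1' : 1 + x != 0 by rewrite gt_eqF.
  have y2 : y ^+ 2 = 1 - x ^+ 2 by rewrite -xy1 addrAC subrr add0r.
  rewrite /I -complexiE; apply/eqP; rewrite eq_complex /=; apply/andP; split; apply/eqP.
    rewrite /s; field: y2; exact: x1'.
  by rewrite /s; field.
have hs0 : 1 + I * s%:C != 0.
  rewrite /I -complexiE eq_complex /= negb_and.
  by rewrite mul0r mulr0 subr0 addr0 oner_neq0.
have hs' : 1 + I * s%:C = tb * (1 - I * s%:C) by rewrite hs mulrA [tb * _]mulrC tab mul1r.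
have i1 : nm (I * tb) <= 1 by rewrite nmM nI ntb mulr1.
have i2' : nm (- (I * tb)) <= 1 by rewrite nmN.
have i3 : nm (I * ta) <= 1 by rewrite nmM nI nta mulr1.
have i4 : nm (- (I * ta)) <= 1 by rewrite nmN.
exists (fun z => (s%:C + z) / (1 + s%:C * z)), (fun z => ((- s)%:C + z) / (1 + (- s)%:C * z)).
(* The linear factors left in the pair once tau^2 is extracted and the Moebius denominators cancel.
   Each contributes a series with coefficients of modulus at most 1, whence the bound 4. *)
exists (fun z => ((1 - (I * tb) * z) * (1 - (- (I * tb)) * z)) *
                 ((1 - (- (I * ta)) * z)^-1 * (1 - (I * ta) * z)^-1)).
exists (fun j => (- log_coef (I * tb) j - log_coef (- (I * tb)) j) +
                 (log_coef (- (I * ta)) j + log_coef (I * ta) j)).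
split; [exact: inner_mobius|exact: inner_mobius| | |].
- apply: explimD; apply: explimD.
  + exact: explim_one_sub.
  + exact: explim_one_sub.
  + exact: explim_one_subV.
  + exact: explim_one_subV.
- split=> [|m]; first by rewrite !log_coef0; ring.
  rewrite (_ : 4 = (1 + 1) + (1 + 1)) ?(le_trans (nmD _ _)) ?lerD //; last by ring.
    by rewrite (le_trans (nmD _ _)) // lerD // nmN log_coef_le.
  by rewrite (le_trans (nmD _ _)) // lerD // log_coef_le.
move=> z zD.
have n1 := one_sub_neq0 i1 zD; have n2 := one_sub_neq0 i2' zD.
have n3 := one_sub_neq0 i3 zD; have n4 := one_sub_neq0 i4 zD.
have sC (a : R) : `|a| < 1 -> 1 + a%:C * z != 0.
  move=> a1; rewrite -[a%:C]opprK mulNr one_sub_neq0 // nmN nm_real ltW //.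
set A := 1 + I * s%:C in hs hs0.
have sI : s%:C - I = - (I * A) by rewrite /A mulrDr mulr1 mulrA -expr2 i2; ring.
have sI' : s%:C + I = I * (ta * A) by rewrite -hs mulrBr mulr1 mulrA -expr2 i2; ring.
set D1 := 1 + s%:C * z; set D2 := 1 + (- s)%:C * z.
have D10 : D1 != 0 := sC _ s1.
have D20 : D2 != 0 := sC _ nNs.
have e1 : 1 - I * ((s%:C + z) / D1) = A * ta * (1 - I * tb * z) / D1.
  apply: (mulIf D10); rewrite mulrBl mul1r mulrA !divfK //.
  have -> : A * ta * (1 - I * tb * z) = ta * A - ta * tb * I * A * z by ring.
  by rewrite tab mul1r -hs -[- (I * A * z)]mulNr -sI /D1; ring.
have e2 : 1 + I * ((s%:C + z) / D1) = A * (1 - - (I * ta) * z) / D1.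
  apply: (mulIf D10); rewrite mulrDl mul1r mulrA !divfK //.
  have -> : A * (1 - - (I * ta) * z) = A + I * (ta * A) * z by ring.
  by rewrite -sI' /D1 /A; ring.
have e3 : 1 + I * (((- s)%:C + z) / D2) = A * ta * (1 - - (I * tb) * z) / D2.
  apply: (mulIf D20); rewrite mulrDl mul1r mulrA !divfK //.
  have -> : A * ta * (1 - - (I * tb) * z) = ta * A - (- (ta * tb * I * A)) * z by ring.
  by rewrite tab mul1r -hs -sI /D2 rmorphN; ring.
have e4 : 1 - I * (((- s)%:C + z) / D2) = A * (1 - I * ta * z) / D2.
  apply: (mulIf D20); rewrite mulrBl mul1r mulrA !divfK //.
  have -> : A * (1 - I * ta * z) = A - I * (ta * A) * z by ring.
  by rewrite -sI' /D2 /A rmorphN; ring.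
rewrite /cayley_pair -/I e1 e2 e3 e4 -ce -/ta; field.
by rewrite D10 D20 hs0 n3 n4.
Qed.

(** Every length up to 2 occurs as a chord of the unit circle, and a rotation gives the chord any
    direction. *)
Lemma unimodular_chord (d : C) : nm d <= 2 ->
  exists ze ze' : C, [/\ nm ze = 1, nm ze' = 1 & ze' - ze = d].
Proof.
move=> d2; pose r := nm d.
have [e [e1 de]] : exists e : C, nm e = 1 /\ d = r%:C * e.
  have [d0|d0] := eqVneq d 0.
    by exists 1; rewrite nm1 /r d0 nm0 mul0r.
  have r0 : r != 0 by rewrite nm_eq0.
  exists (d / r%:C); rewrite nmM nmV nm_real ger0_norm ?nm_ge0 // divff //.
  by rewrite mulrCA divff ?mulr1 // -nm_eq0 nm_real normr_eq0.
have r0 : 0 <= r := nm_ge0 _.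
pose h := Num.sqrt (1 - (r / 2) ^+ 2).
have hh : (r / 2) ^+ 2 + h ^+ 2 = 1.
  rewrite sqr_sqrtr; first by rewrite addrC subrK.
  by rewrite subr_ge0 exprn_ile1 ?divr_ge0 // ler_pdivrMr // mul1r.
(* Endpoints of the horizontal chord of length r at height h, rotated by the direction e of d. *)
exists (e * ((- (r / 2)) +i* h)), (e * ((r / 2) +i* h)); split.
- by rewrite nmM e1 mul1r /= sqrrN hh sqrtr1.
- by rewrite nmM e1 mul1r /= hh sqrtr1.
rewrite -mulrBr de mulrC; congr (_ * _); apply/eqP; rewrite eq_complex /= subrr eqxx andbT.
by apply/eqP; field.
Qed.

(** The factor j will cancel the 1 / j of the logarithmic series, so that the coefficients at higher
    multiples of k do not exceed the one at k. *)
Lemma nm_subX_le (x y : C) j : nm x = 1 -> nm y = 1 ->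
  nm (x ^+ j - y ^+ j) <= j%:R * nm (x - y).
Proof.
move=> x1 y1; rewrite subrXX nmM mulrC ler_wpM2r ?nm_ge0 // (le_trans (nm_sum _ _ _)) //.
rewrite (eq_bigr (fun=> 1)); last by move=> i _; rewrite nmM !nmX x1 y1 !expr1n mulr1.
by rewrite sumr_const card_ord.
Qed.

Lemma inner_pair_dose (k : nat) (d : C) : (0 < k)%N -> nm d <= 1 ->
  exists (p q G : C -> C) (b : nat -> C),
    [/\ inner p, inner q, explim b G,
        [/\ b k = d, forall m, ~~ (k %| m)%N -> b m = 0, b 0%N = 0 & forall m, nm (b m) <= nm d] &
        forall z, disk z -> cayley_pair (p z) (q z) = G z].
Proof.
move=> k0 d1; set I : C := 'i%R.
have i2 : I ^+ 2 = -1 := sqrCi _.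
have nI : nm I = 1 := nm_im.
have n2 : nm 2 = 2 := nm_nat R 2.
have I0 : I != 0 by rewrite -nm_eq0 nI oner_neq0.
(* The coefficient of z^k will be 2i(ze' - ze), which has to equal d. *)
have [|ze [ze' [ze1 ze1' zd]]] := @unimodular_chord (d / (2 * I)).
  by rewrite nmM nmV nmM nI n2 mulr1 ler_pdivrMr //; lra.
have i1 : nm (I * ze) <= 1 by rewrite nmM nI ze1 mulr1.
have i2' : nm (- (I * ze)) <= 1 by rewrite nmN.
have i3 : nm (I * ze') <= 1 by rewrite nmM nI ze1' mulr1.
have i4 : nm (- (I * ze')) <= 1 by rewrite nmN.
pose b0 j := (- log_coef (I * ze) j + log_coef (- (I * ze)) j) +
             (- log_coef (- (I * ze')) j + log_coef (I * ze') j).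
exists (fun z => ze * z ^+ k), (fun z => ze' * z ^+ k).
exists (fun z => ((1 - (I * ze) * z ^+ k) * (1 - (- (I * ze)) * z ^+ k)^-1) *
                 ((1 - (- (I * ze')) * z ^+ k) * (1 - (I * ze') * z ^+ k)^-1)).
exists (dilate k b0).
have b0E j : b0 j = (1 - (-1) ^+ j) * (I ^+ j * (ze' ^+ j - ze ^+ j) / j%:R).
  by rewrite /b0 /log_coef -[- (I * ze)]mulN1r -[- (I * ze')]mulN1r !exprMn; ring.
have b00 : b0 0%N = 0 by rewrite /b0 !log_coef0; ring.
have dE : 2 * I * (ze' - ze) = d.
  by rewrite zd mulrCA divff ?mulr1 // mulf_neq0 // pnatr_eq0.
split; [exact: inner_monomial|exact: inner_monomial| | |].
- apply: (explim_dilate k0 (F := fun z => ((1 - (I * ze) * z) * (1 - (- (I * ze)) * z)^-1) *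
                 ((1 - (- (I * ze')) * z) * (1 - (I * ze') * z)^-1))).
  apply: explimD; apply: explimD; [exact: explim_one_sub|exact: explim_one_subV|
    exact: explim_one_sub|exact: explim_one_subV].
- split=> [|m km||m].
  + have kk : (k %/ k = 1)%N by rewrite divnn k0.
    by rewrite /dilate dvdnn kk b0E !expr1 divr1 -dE; ring.
  + by rewrite /dilate (negbTE km).
  + by rewrite /dilate dvdn0 div0n.
  rewrite /dilate; case: ifP => _; last by rewrite nm0 nm_ge0.
  case: (m %/ k)%N => [|j]; first by rewrite b00 nm0 nm_ge0.
  (* The factor 1 - (-1)^j has modulus at most 2, and [nm_subX_le] absorbs the division by j. *)
  rewrite b0E -dE !nmM nmX nI expr1n mulr1 mul1r n2 nmV nm_nat.
  apply: ler_pM; [exact: nm_ge0|by rewrite divr_ge0 ?nm_ge0| |].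
    by rewrite (le_trans (nmB _ _)) // nmX nmN nm1 expr1n; lra.
  by rewrite ler_pdivrMr ?ltr0n // mulrC nm_subX_le.
by move=> z _; rewrite /cayley_pair -/I !mulNr !opprK !mulrA.
Qed.

End InnerPairs.

(** * Greedy cancellation of the coefficients *)

Section Greedy.
Variable R : realType.
Local Notation C := R[i].
Local Notation nm := (@ComplexField.Normc.normc R).

(** Times n, this bounds what all exponents i < k add to the coefficient of z^m: i is used n i^2
    times, each use changes only coefficients at multiples of i, and by at most 1. *)
Definition div_sqr_sum (k m : nat) : R :=
  \sum_(i < k | (0 < i)%N && (i %| m)%N) (i%:R) ^+ 2.

Lemma div_sqr_sumS k m : div_sqr_sum k.+1 m =
  div_sqr_sum k m + (if (0 < k)%N && (k %| m)%N then k%:R ^+ 2 else 0).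
Proof. by rewrite /div_sqr_sum big_mkcond big_ord_recr /= -big_mkcond. Qed.

Lemma div_sqr_sum_mono k k' m : (k <= k')%N -> div_sqr_sum k m <= div_sqr_sum k' m.
Proof.
move=> /subnKC <-; elim: (k' - k)%N => [|n ih]; first by rewrite addn0.
rewrite addnS div_sqr_sumS (le_trans ih) // lerDl.
by case: ifP => // _; rewrite sqr_ge0.
Qed.

(* Writing i = m/j, the sum over the proper divisors is at most
   m^2 (1/(1*2) + 1/(2*3) + ... + 1/((m-1)*m)) = m^2 - m. *)
Lemma div_sqr_sum_le m : (0 < m)%N -> 1 + div_sqr_sum m m <= m%:R ^+ 2.
Proof.
(* [g j] dominates (m / j)^2 for j > 1 and telescopes; it is 0 for j <= 1 because j = 1 would
   correspond to the divisor m itself. *)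
move=> m0; pose g (j : nat) : R := if (1 < j)%N then m%:R ^+ 2 * (j.-1%:R^-1 - j%:R^-1) else 0.
have gsum n : \sum_(j < n.+2) g j = m%:R ^+ 2 * (1 - n.+1%:R^-1).
  elim: n => [|n ih]; first by rewrite !big_ord_recr big_ord0 /g /= invr1; ring.
  by rewrite big_ord_recr /= ih /g /=; ring.
(* The involution i -> m / i on the divisors of m, by which the sum is reindexed. *)
pose h (i : 'I_m.+1) : 'I_m.+1 := inord (m %/ i).
have hE (i : 'I_m.+1) : h i = (m %/ i)%N :> nat by rewrite /h inordK // ltnS leq_div.
pose P (i : 'I_m.+1) := [&& (i < m)%N, (0 < i)%N & (i %| m)%N].
have -> : div_sqr_sum m m = \sum_(i < m.+1 | P i) i%:R ^+ 2.
  rewrite /div_sqr_sum [RHS]big_mkcond big_ord_recr /= /P ltnn /= addr0 big_mkcond.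
  by apply: eq_bigr => i _; rewrite /= ltn_ord.
rewrite (reindex_onto h h); last first.
  move=> i /and3P[im i0 id]; apply: val_inj; rewrite /= !hE.
  by rewrite divnA // mulKn.
apply: (@le_trans _ _ (1 + \sum_(j < m.+1) g j)).
  rewrite lerD2l [leLHS]big_mkcond; apply: ler_sum => j _; case: ifP; last first.
    move=> _; rewrite /g; case: ifP => // j1.
    rewrite mulr_ge0 ?sqr_ge0 // subr_ge0 lef_pV2 ?posrE ?ltr0n ?ler_nat ?leq_pred //.
      by rewrite (ltn_trans _ j1).
    by rewrite -ltnS prednK // (ltn_trans _ j1).
  move=> /andP[/and3P[im i0 id] /eqP jE].
  have hj : (h j * j)%N = m.
    have <- : (m %/ h j)%N = j by rewrite -hE jE.
    by rewrite mulnC divnK.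
  have j0 : (0 < j)%N.
    by have : (0 < h j * j)%N; [rewrite hj | rewrite muln_gt0 => /andP[]].
  have j1 : (1 < j)%N.
    rewrite ltn_neqAle j0 andbT; apply/eqP => j1.
    by have := hj; rewrite -j1 muln1 => e; rewrite e ltnn in im.
  have jp : (0 < j.-1)%N by rewrite -ltnS prednK.
  have mE : (m%:R : R) = (h j)%:R * j%:R by rewrite -natrM hj.
  rewrite /g j1 mE.
  have -> : (j%:R : R) = j.-1%:R + 1 by rewrite -[in LHS](prednK j0) -addn1 natrD.
  have : 0 < j.-1%:R :> R by rewrite ltr0n.
  move: (j.-1%:R : R) ((h j)%:R : R) => x y x0.
  have x1 : 0 < x + 1 by rewrite addr_gt0.
  (* Here x = j - 1 and y = m / j, so that m = y (x + 1). *)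
  rewrite (_ : _ * (_ - _) = y ^+ 2 + y ^+ 2 / x); last by field; rewrite !gt_eqF.
  by rewrite lerDl divr_ge0 ?sqr_ge0 // ltW.
case: m m0 @g gsum {h hE P} => // m _ g gsum; rewrite gsum.
have : 1 <= m.+1%:R :> R by rewrite ler1n.
move: (m.+1%:R : R) => x x1.
rewrite (_ : x ^+ 2 * _ = x ^+ 2 - x); last by field; rewrite gt_eqF // (lt_le_trans _ x1).
by lra.
Qed.

Variables (n : nat) (r0 : nat -> C).
Hypotheses (n_gt0 : (0 < n)%N) (r00 : r0 0%N = 0) (r0_le : forall m, nm (r0 m) <= n%:R).

(* (k, j): at this step the exponent is k, and j steps with exponent k remain. *)
Fixpoint schedule (N : nat) : nat * nat :=
  if N is N'.+1 then
    let: (k, j) := schedule N' in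
    if (j <= 1)%N then (k.+1, n * k.+1 ^ 2)%N else (k, j.-1)
  else (1, n)%N.

Lemma schedule_bound N : let: (k, j) := schedule N in (0 < k)%N && (0 < j <= n * k ^ 2)%N.
Proof.
elim: N => [|N] /=; first by rewrite n_gt0 exp1n muln1 leqnn.
case: (schedule N) => k j /andP[k0 /andP[j0 jn]]; case: ifP => [_|].
  by rewrite /= leqnn andbT muln_gt0 n_gt0 expn_gt0.
move/negbT; rewrite -ltnNge => j1; rewrite k0 /= -ltnS prednK // j1 /=.
by rewrite (leq_trans (leq_pred _)).
Qed.

Lemma schedule_mono N N' : (N <= N')%N -> ((schedule N).1 <= (schedule N').1)%N.
Proof.
move=> /subnKC <-; elim: (N' - N)%N => [|d ih]; first by rewrite addn0.
rewrite addnS (leq_trans ih) //=; case: (schedule _) => k j.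
by case: ifP => //= _.
Qed.

(** By induction on the number of uses left, every exponent is eventually exhausted and replaced by
    the next. *)
Lemma schedule_unbounded K : exists N, (K <= (schedule N).1)%N.
Proof.
elim: K => [|K [N KN]]; first by exists 0%N.
suff [N' h] : exists N', ((schedule N).1 < (schedule N').1)%N.
  by exists N'; rewrite (leq_ltn_trans KN).
have [J] := ubnP (schedule N).2; elim: J N {KN} => // J ih N jJ.
have := schedule_bound N; have E : schedule N.+1 = let: (k, j) := schedule N in
    if (j <= 1)%N then (k.+1, n * k.+1 ^ 2)%N else (k, j.-1) by [].
case: (schedule N) E jJ => k j E jJ /andP[_ /andP[j0 _]].
case: ifP E => [_|/negbT j1] E; first by exists N.+1; rewrite E.
have [|N' hN'] := ih N.+1.
  by rewrite E /= -ltnS prednK // (leq_trans _ jJ) // ltnS.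
by exists N'; move: hN'; rewrite E.
Qed.

(** [B (k, d)] stands for the coefficients supplied by [inner_pair_dose]; the greedy argument sees
    only the properties in [BP]. *)
Variable B : nat * C -> nat -> C.
Hypothesis BP : forall k d, (0 < k)%N -> nm d <= 1 ->
  [/\ B (k, d) k = d, forall m, ~~ (k %| m)%N -> B (k, d) m = 0,
      B (k, d) 0%N = 0 & forall m, nm (B (k, d) m) <= nm d].

(** The coefficient still present at k is divided evenly among the j remaining uses of k, so the
    last one cancels it exactly. *)
Definition dose (r : nat -> C) (kj : nat * nat) : nat * C := (kj.1, r kj.1 / kj.2%:R).

Fixpoint residual (N : nat) : nat -> C :=
  if N is N'.+1 then
    fun m => residual N' m - B (dose (residual N') (schedule N')) m
  else r0.

(** Below k everything is cancelled; at k the coefficient is small enough for j doses of modulus at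
    most 1. Above k the bound adds the initial n, the effect of the exhausted exponents, and the n
    k^2 - j uses of k made so far. *)
Lemma residual_invariant N : let: (k, j) := schedule N in
  [/\ forall m, (m < k)%N -> residual N m = 0,
      nm (residual N k) <= j%:R &
      forall m, (k < m)%N -> nm (residual N m) <= n%:R + n%:R * div_sqr_sum k m +
        (if (k %| m)%N then n%:R * k%:R ^+ 2 - j%:R else 0)].
Proof.
elim: N => [|N] /=.
  split=> [m||m m1]; [by rewrite ltnS leqn0 => /eqP ->|exact: r0_le|].
  rewrite dvd1n expr1n mulr1 subrr addr0 (le_trans (r0_le m)) // lerDl mulr_ge0 //.
  by rewrite sumr_ge0 // => i _; rewrite sqr_ge0.
have := schedule_bound N.
case: (schedule N) => k j /andP[k0 /andP[j0 jn]] [h1 h2 h3].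
set r := residual N in h1 h2 h3 *; set d := r k / j%:R.
have jR : 0 < j%:R :> R by rewrite ltr0n.
have d1 : nm d <= 1 by rewrite nmM nmV nm_nat ler_pdivrMr // mul1r.
have [b1 b2 b3 b4] := BP k0 d1; rewrite /dose /= -/d.
have h1' m : (m < k)%N -> r m - B (k, d) m = 0.
  move=> mk; rewrite h1 // sub0r; case: m mk => [|m] mk; first by rewrite b3 oppr0.
  by rewrite b2 ?oppr0 // gtnNdvd.
have h3' m : (k < m)%N -> nm (r m - B (k, d) m) <= n%:R + n%:R * div_sqr_sum k m +
    (if (k %| m)%N then n%:R * k%:R ^+ 2 - (j%:R - 1) else 0).
  move=> km; have := h3 m km; case: ifP => [kdm|/negbT/b2 -> h]; last by rewrite subr0.
  move=> h; rewrite (le_trans (nmB _ _)) // (le_trans (lerD h (le_trans (b4 m) d1))) //.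
  by rewrite le_eqVlt; apply/orP; left; apply/eqP; ring.
case: ifP => [j1|/negbT]; last rewrite -ltnNge => j1.
  (* Last use of k: with it the uses of k number n k^2, which is n times the new term of
     [div_sqr_sum k.+1]. *)
  have je : j = 1%N by apply/eqP; rewrite eqn_leq j1.
  have h3'' m : (k < m)%N -> nm (r m - B (k, d) m) <= n%:R + n%:R * div_sqr_sum k.+1 m.
    move=> /h3' h; rewrite (le_trans h) // div_sqr_sumS k0 je subrr subr0 mulrDr /= addrA.
    by rewrite lerD2l; case: ifP; rewrite ?mulr0.
  split=> [m||m km].
  - rewrite ltnS leq_eqVlt => /orP[/eqP -> |]; last exact: h1'.
    by rewrite b1 /d je divr1 subrr.
  (* [div_sqr_sum_le] at k + 1: the coefficient accumulated there fits into the n (k + 1)^2 uses now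
     granted. *)
  - rewrite (le_trans (h3'' _ (ltnSn _))) // natrM natrX -[X in X + _]mulr1 -mulrDr.
    by rewrite ler_wpM2l // div_sqr_sum_le.
  rewrite (le_trans (h3'' _ (ltnW km))) // lerDl.
  by rewrite natrM natrX subrr; case: ifP.
split=> [//||m km].
- rewrite b1 /d; have jn0 : j%:R != 0 :> C by rewrite pnatr_eq0 -lt0n.
  (* Removing the share 1 / j leaves (j - 1) / j of a coefficient bounded by j. *)
  have -> : r k - r k / j%:R = r k * (j.-1%:R / j%:R).
    have -> : (j.-1%:R : C) = j%:R - 1 by rewrite -[in RHS](prednK j0) -addn1 natrD addrK.
    by field.
  rewrite !nmM nmV !nm_nat (le_trans (ler_wpM2r _ h2)) ?divr_ge0 //.
  by rewrite mulrCA divff ?mulr1 // gt_eqF.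
have -> : (j.-1%:R : R) = j%:R - 1 by rewrite -[in RHS](prednK j0) -addn1 natrD addrK.
exact: h3'.
Qed.

Lemma residual_eq0 N m : (m < (schedule N).1)%N -> residual N m = 0.
Proof. by have := residual_invariant N; case: (schedule N) => k j [h _ _] /h. Qed.

(** For m > k the three terms of the invariant together are at most n (1 + [div_sqr_sum m m]). The
    bound is independent of N, as the tail estimate requires. *)
Lemma residual_le N m : nm (residual N m) <= n%:R * m%:R ^+ 2.
Proof.
have := residual_invariant N; have := schedule_bound N.
case: (schedule N) => k j /andP[k0 /andP[j0 jn]] [h1 h2 h3].
have [mk|km|->] := ltngtP m k.
- by rewrite h1 // nm0 mulr_ge0 ?sqr_ge0.
- rewrite (le_trans (h3 m km)) //.
  apply: (@le_trans _ _ (n%:R + n%:R * div_sqr_sum k.+1 m)).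
    rewrite div_sqr_sumS k0 /= mulrDr addrA lerD2l.
    by case: ifP => _; rewrite ?mulr0 // gerBl.
  rewrite -[X in X + _]mulr1 -mulrDr ler_wpM2l //.
  rewrite (le_trans _ (div_sqr_sum_le (leq_ltn_trans _ km))) //.
  by rewrite lerD2l div_sqr_sum_mono.
- by rewrite (le_trans h2) // -natrX -natrM ler_nat.
Qed.

Lemma dose_ok N : (0 < (schedule N).1)%N /\
  nm (dose (residual N) (schedule N)).2 <= 1.
Proof.
have := residual_invariant N; have := schedule_bound N.
case: (schedule N) => k j /andP[k0 /andP[j0 jn]] [_ h2 _]; split=> //.
by rewrite /= nmM nmV nm_nat ler_pdivrMr ?mul1r // ltr0n.
Qed.

End Greedy.

(** * Compactness, tail estimates and comparison of exponentials *)

Section Assembly.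
Variable R : realType.
Local Notation C := R[i].
Local Notation nm := (@ComplexField.Normc.normc R).

(** Near each point of the disk |w| <= 1 - 1/(n + 1) holds for all large n; compactness lets one n
    serve all of K. *)
Lemma compact_disk_radius (K : set C) : compact K -> K `<=` disk (R:=R) ->
  exists rho : R, 0 <= rho < 1 /\ forall z, K z -> nm z <= rho.
Proof.
move=> /compact_near_coveringP cK Kd.
have [|N _ hN] := cK nat \oo (fun n z => nm z <= 1 - n.+1%:R^-1) _.
  move=> z /Kd /diskE z1; set e := (1 - nm z) / 2.
  have e0 : 0 < e by rewrite divr_gt0 // subr_gt0.
  have /cvg_nmP/(_ e e0) hz : (fun w : C => w) @ z --> z by exact: cvg_id.
  have /cvgrPdist_lt/(_ e e0) he := @cvg_harmonic R.
  exists ([set w | nm (w - z) < e], [set n | `|0 - harmonic n| < e]); first by split.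
  move=> [w n] /= [hw]; rewrite sub0r normrN /harmonic /= => hn.
  have := nmD (w - z) z; rewrite subrK => h1.
  have e2 : 2 * e = 1 - nm z by rewrite /e mulrC divfK.
  have aux (x y v d t : R) : x <= y + v -> y < d -> 2 * d = 1 - v -> t < d -> x <= 1 - t by lra.
  exact: aux h1 hw e2 (le_lt_trans (ler_norm _) hn).
exists (1 - N.+1%:R^-1); split; last by move=> z Kz; exact: (hN N (leqnn N) z Kz).
rewrite subr_ge0 invf_le1 ?ltr0n // ler1n /= -subr_gt0 opprB addrC subrK.
by rewrite invr_gt0 ltr0n.
Qed.

Lemma cvg_nm_le (u : nat -> C) (l : C) (B : R) : u @ \oo --> l ->
  (forall M, nm (u M) <= B) -> nm l <= B.
Proof.
move=> /cvg_nmP ul uB; apply/ler_addgt0Pr => e /ul [M _ hM].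
have := hM M (leqnn M) => /= h.
rewrite -[l](subKr (u M)) (le_trans (nmB _ _)) // lerD ?uB //.
exact: ltW.
Qed.

Lemma bernoulli_le (x : R) m : 0 <= x -> m%:R * x <= (1 + x) ^+ m.
Proof.
move=> x0; suff : 1 + m%:R * x <= (1 + x) ^+ m by apply: le_trans; rewrite lerDr.
elim: m => [|m ih]; first by rewrite mul0r addr0.
rewrite exprSr (le_trans _ (ler_wpM2r _ ih)) ?addr_ge0 // -addn1 natrD.
have : 0 <= m%:R * x * x by rewrite !mulr_ge0.
by move: (m%:R : R) => y h; nra.
Qed.

(** The decay is split in two equal factors: one will measure the start of the tail, the other keeps
    the series summable. *)
Lemma sqr_geom_le (rho : R) : 0 <= rho < 1 ->
  exists sg K : R, [/\ 0 <= sg < 1, 0 <= K &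
    forall m, m%:R ^+ 2 * rho ^+ m <= K * (sg ^+ m * sg ^+ m)].
Proof.
(* For 0 <= x <= 1, (1 + x)^4 <= 1 + 15 x = 2 - rho, and rho (2 - rho) <= 1. Of the four powers of 1
   + x, two absorb m^2 by Bernoulli's inequality and two remain. *)
move=> /andP[rho0 rho1]; pose x := (1 - rho) / 15.
have x0 : 0 < x by rewrite divr_gt0 // subr_gt0.
have x1 : 0 < 1 + x by rewrite addr_gt0.
exists (1 + x)^-1, (x ^- 2); split.
- by rewrite invr_ge0 (ltW x1) invf_lt1 // ltrDl.
- by rewrite invr_ge0 sqr_ge0.
move=> m.
have hr : rho <= (1 + x)^-1 ^+ 4.
  rewrite exprVn -[leRHS]mul1r ler_pdivlMr ?exprn_gt0 //.
  have xle1 : x <= 1 by rewrite ler_pdivrMr //; lra.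
  have xp k : x ^+ k.+1 <= x by rewrite -[leRHS]expr1 ler_wiXn2l // ltW.
  have x15 : 15 * x = 1 - rho by rewrite /x mulrC divfK.
  have h4 : (1 + x) ^+ 4 <= 1 + 15 * x.
    have -> : (1 + x) ^+ 4 = 1 + 4 * x + 6 * x ^+ 2 + 4 * x ^+ 3 + x ^+ 4 by ring.
    have := xp 1%N; have := xp 2%N; have := xp 3%N; lra.
  rewrite (le_trans (ler_wpM2l rho0 h4)) // x15; nra.
have hm : m%:R <= (1 + x) ^+ m / x by rewrite ler_pdivlMr // bernoulli_le // ltW.
have hm2 : m%:R ^+ 2 <= ((1 + x) ^+ m / x) ^+ 2.
  by rewrite lerXn2r ?nnegrE // divr_ge0 ?exprn_ge0 ?ltW.
have hrm : rho ^+ m <= ((1 + x)^-1 ^+ 4) ^+ m.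
  by rewrite lerXn2r ?nnegrE // ?exprn_ge0 ?invr_ge0 ?ltW.
rewrite (le_trans (ler_pM _ _ hm2 hrm)) ?sqr_ge0 ?exprn_ge0 //.
rewrite le_eqVlt; apply/orP; left; apply/eqP.
have y0 : (1 + x) ^+ m != 0 by rewrite expf_neq0 // gt_eqF.
rewrite -exprM mulnC exprM exprVn; move: ((1 + x) ^+ m) y0 => y y0.
by field; rewrite y0 gt_eqF.
Qed.

(** Only m >= k contribute, where sg^m <= sg^k; the second factor sg^m is summed geometrically. The
    constants depend on rho and n alone. *)
Lemma psum_tail_le (rho : R) (n : nat) : 0 <= rho < 1 ->
  exists sg K : R, [/\ 0 <= sg < 1, 0 <= K & forall (r : nat -> C) k M z,
    (forall m, (m < k)%N -> r m = 0) -> (forall m, nm (r m) <= n%:R * m%:R ^+ 2) ->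
    nm z <= rho -> nm (psum r M z) <= K * sg ^+ k].
Proof.
move=> rho01; have [sg [K [sg01 K0 hK]]] := sqr_geom_le rho01.
have /andP[sg0 sg1] := sg01; have /andP[rho0 rho1] := rho01.
exists sg, (n%:R * K * (1 - sg)^-1); split=> //.
  by rewrite !mulr_ge0 // invr_ge0 subr_ge0 ltW.
move=> r k M z rk rn zr; rewrite (le_trans (nm_sum _ _ _)) //.
apply: (@le_trans _ _ (\sum_(m < M) n%:R * K * sg ^+ k * sg ^+ m)); last first.
  rewrite -mulr_sumr mulrAC ler_wpM2r ?exprn_ge0 // ler_wpM2l ?mulr_ge0 //.
  exact: geom_sum_le.
apply: ler_sum => m _; have [mk|km] := ltnP m k.
  by rewrite rk // mul0r nm0 !mulr_ge0 ?exprn_ge0.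
rewrite nmM nmX.
apply: (@le_trans _ _ (n%:R * m%:R ^+ 2 * rho ^+ m)).
  by rewrite ler_pM ?exprn_ge0 ?nm_ge0 // lerXn2r ?nnegrE ?nm_ge0.
have -> : n%:R * m%:R ^+ 2 * rho ^+ m = n%:R * (m%:R ^+ 2 * rho ^+ m) by ring.
have -> : n%:R * K * sg ^+ k * sg ^+ m = n%:R * (K * (sg ^+ k * sg ^+ m)) by ring.
rewrite ler_wpM2l // (le_trans (hK m)) // ler_wpM2l //.
by rewrite ler_wpM2r ?exprn_ge0 // ler_wiXn2l // ltW.
Qed.

(** At the level of partial sums exp(a - r) - exp(a) = exp(a) (exp(-r) - 1); the estimates are
    uniform in M and pass to the limit. *)
Lemma explim_sub_le (a r : nat -> C) (G H : C -> C) (A rho T : R) z :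
  0 <= rho < 1 -> nm z <= rho -> 0 <= T <= 1 ->
  (forall m, nm (a m) <= A) -> (forall M, nm (psum r M z) <= T) ->
  explim a G -> explim (fun m => a m - r m) H ->
  nm (G z) <= expR (A * (1 - rho)^-1) /\
  nm (H z - G z) <= expR (A * (1 - rho)^-1) * (2 * expR 1 * T).
Proof.
move=> rho01 zr /andP[T0 T1] aA rT aG arH.
have /andP[rho0 rho1] := rho01.
have zD : disk z by apply/diskE; rewrite (le_lt_trans zr).
have A0 : 0 <= A := le_trans (nm_ge0 _) (aA 0%N).
have aE M : nm (cexp (psum a M z)) <= expR (A * (1 - rho)^-1).
  rewrite (le_trans (nm_cexp_le _)) // ler_expR (le_trans (nm_sum _ _ _)) //.
  apply: (@le_trans _ _ (\sum_(m < M) A * rho ^+ m)).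
    apply: ler_sum => m _; rewrite nmM nmX ler_pM ?exprn_ge0 ?nm_ge0 //.
    by rewrite lerXn2r ?nnegrE ?nm_ge0.
  by rewrite -mulr_sumr ler_wpM2l // geom_sum_le.
split; first exact: cvg_nm_le (aG z zD) aE.
have d : (fun M => cexp (psum (fun m => a m - r m) M z) - cexp (psum a M z)) @ \oo --> H z - G z.
  exact: (@cvgB C C^o _ _ _ _ _ _ _ (arH z zD) (aG z zD)).
apply: cvg_nm_le d _ => M.
have -> : cexp (psum (fun m => a m - r m) M z) - cexp (psum a M z) =
    cexp (psum a M z) * (cexp (- psum r M z) - 1).
  by rewrite psumD psumN cexpD mulrBr mulr1.
rewrite nmM ler_pM ?nm_ge0 // (le_trans (nm_cexpB1 _)) // nmN -mulrA ler_wpM2l // mulrC.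
by rewrite ler_pM ?expR_ge0 ?nm_ge0 // ler_expR (le_trans (rT M)).
Qed.

End Assembly.

(** * Choice of the inner functions and convergence on compact sets *)

Unset Implicit Arguments.

Local Notation nm := (@ComplexField.Normc.normc _).

Theorem theorem6p1 (R : realType) (f : R[i] -> R[i]) :
  RO f ->
  exists pp pm : nat -> R[i] -> R[i],
    (forall n, inner (pp n)) /\ (forall n, inner (pm n)) /\
    (* locally uniform convergence on the disk *)
    forall K : set R[i], compact K -> K `<=` disk (R:=R) ->
      forall e : R, (0 < e)%R ->
        \forall N \near \oo, forall z, K z ->
          `|ROprod (`|f 0|) pp pm N z - f z| < e%:C.
Proof.
move=> [_ [/outer_power_series[c [a [A [G [c1 a0 aA aG fE]]]]] _]].
have [p0 [q0 [G0 [b0 [ip0 iq0 bG0 [b00 b0_le] pairE0]]]]] := inner_pair_unimodular c1.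
have A0 : 0 <= A := le_trans (nm_ge0 _) (aA 0%N).
(* A bounds the coefficients of f, and 4 those of the first pair, which is removed before the greedy
   process starts. *)
have [n n_gt0 An] : exists2 n : nat, (0 < n)%N & A + 4 <= n%:R.
  exists (Num.trunc (A + 4)).+1 => //; apply: ltW; exact: truncnS_gt.
pose r0 m := a m - b0 m.
have r00 : r0 0%N = 0 by rewrite /r0 a0 b00 subrr.
have r0_le m : nm (r0 m) <= n%:R.
  by rewrite (le_trans _ An) // (le_trans (nmB _ _)) // lerD.
(* One choice for all (k, d), with dummy values when k = 0 or |d| > 1; [dose_ok] keeps the recursion
   away from those. *)
have /choice[Q QP] : forall kd : nat * R[i], exists Q :
      (R[i] -> R[i]) * (R[i] -> R[i]) * (R[i] -> R[i]) * (nat -> R[i]),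
    (0 < kd.1)%N -> nm kd.2 <= 1 ->
    [/\ inner Q.1.1.1, inner Q.1.1.2, explim Q.2 Q.1.2,
        [/\ Q.2 kd.1 = kd.2, forall m, ~~ (kd.1 %| m)%N -> Q.2 m = 0, Q.2 0%N = 0 &
            forall m, nm (Q.2 m) <= nm kd.2] &
        forall z, disk z -> cayley_pair (Q.1.1.1 z) (Q.1.1.2 z) = Q.1.2 z].
  move=> [k d] /=; case: (posnP k) => [->|k0].
    by exists (id, id, id, fun=> 0).
  have [d1|d1] := leP (nm d) 1; last first.
    by exists (id, id, id, fun=> 0).
  by have [p [q [H [b h]]]] := inner_pair_dose k0 d1; exists (p, q, H, b).
pose B kd := (Q kd).2.
have BP k d (k0 : (0 < k)%N) (d1 : nm d <= 1) :
    [/\ B (k, d) k = d, forall m, ~~ (k %| m)%N -> B (k, d) m = 0,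
      B (k, d) 0%N = 0 & forall m, nm (B (k, d) m) <= nm d].
  by have [_ _ _] := QP (k, d) k0 d1.
pose r := residual n r0 B.
pose kd N := dose (r N) (schedule n N).
have kdP N : [/\ inner (Q (kd N)).1.1.1, inner (Q (kd N)).1.1.2, explim (B (kd N)) (Q (kd N)).1.2 &
        forall z, disk z -> cayley_pair ((Q (kd N)).1.1.1 z) ((Q (kd N)).1.1.2 z) = (Q (kd N)).1.2 z].
  have [k0 d1] := dose_ok n_gt0 r00 r0_le BP N.
  by have [] := QP (kd N) k0 d1.
(* Index 0 carries the pair producing c, so dose N sits at index N + 1. *)
exists (fun N => if N is N'.+1 then (Q (kd N')).1.1.1 else p0).
exists (fun N => if N is N'.+1 then (Q (kd N')).1.1.2 else q0).
split; first by case=> // N; case: (kdP N).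
split; first by case=> // N; case: (kdP N).
move=> K cK Kd e e0.
have [rho [rho01 Krho]] := compact_disk_radius cK Kd.
have [sg [L [/andP[sg0 sg1] L0 tail]]] := psum_tail_le n rho01.
(* The partial product without |f(0)| and c; its logarithm has coefficients [a m - r N m]. *)
pose H N z := G0 z * \prod_(i < N) (Q (kd i)).1.2 z.
have HP N : explim (fun m => a m - r N m) (H N).
  elim: N => [|N ih].
    apply: explim_eq bG0 _ _ => [m|z _]; first by rewrite /r /= /r0 subKr.
    by rewrite /H big_ord0 mulr1.
  have [_ _ hQ _] := kdP N.
  apply: explim_eq (explimD ih hQ) _ _ => [m|z _].
    by rewrite /r /= -/r opprB addrA addrAC.
  by rewrite /H big_ord_recr /= mulrA.
pose F := `|f 0|.
have FE : F = (nm (f 0))%:C by [].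
have prodE N z : disk z -> ROprod F (fun N => if N is N'.+1 then (Q (kd N')).1.1.1 else p0)
    (fun N => if N is N'.+1 then (Q (kd N')).1.1.2 else q0) N.+1 z = F * (c * H N z).
  move=> zD; rewrite /ROprod big_ord_recl -/(cayley_pair (p0 z) (q0 z)) pairE0 // /H mulrA.
  congr (_ * (_ * _)); apply: eq_bigr => i _ /=.
  have [_ _ _ h] := kdP i; rewrite -h //.
set E := expR (A * (1 - rho)^-1).
(* The error will be at most T X for a tail bound T <= 1; the summand 1 secures X > 0. *)
pose X := (nm (f 0) + 1) * (E * (2 * expR 1)).
have E0 : 0 < E by rewrite expR_gt0.
have X0 : 0 < X.
  by rewrite !mulr_gt0 ?expR_gt0 // ltr_wpDl ?nm_ge0.
have m0 : 0 < Num.min 1 (e / X) by rewrite lt_min ltr01 divr_gt0.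
have sg1' : `|sg| < 1 by rewrite ger0_norm.
have /cvgrPdist_lt/(_ _ m0)[k1 _ hk1] := cvg_geometric L sg1'.
have [N1 hN1] := schedule_unbounded n_gt0 k1.
(* The shift by one accounts for the pair at index 0 and excludes the empty product. *)
exists N1.+1 => // -[//|N] /= NN1 z Kz.
have zr := Krho z Kz; have zD := Kd z Kz.
pose T := L * sg ^+ (schedule n N).1.
have T0 : 0 <= T by rewrite mulr_ge0 ?exprn_ge0.
have : `|0 - geometric L sg (schedule n N).1| < Num.min 1 (e / X).
  apply: hk1 => /=; apply: leq_trans hN1 _; exact: schedule_mono.
rewrite sub0r normrN /geometric /= -/T ger0_norm // lt_min => /andP[T1 TX].
have T01 : 0 <= T <= 1 by rewrite T0 ltW.
have rT M : nm (psum (r N) M z) <= T.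
  apply: tail zr; first exact: (residual_eq0 n_gt0 r00 r0_le BP).
  exact: (residual_le n_gt0 r00 r0_le BP).
have [_ d] := explim_sub_le rho01 zr T01 aA rT aG (HP N).
rewrite prodE // fE // -/F -mulrA -!mulrBr normE !nmM c1 mul1r ltcR FE nm_real.
rewrite ger0_norm ?nm_ge0 //.
apply: le_lt_trans (ler_wpM2l (nm_ge0 _) d) _; rewrite -/E.
move: TX; rewrite ltr_pdivlMr // => TX; apply: le_lt_trans TX.
have -> : T * X = (nm (f 0) + 1) * (E * (2 * expR 1 * T)).
  by rewrite /X; ring.
rewrite ler_wpM2r ?lerDl // mulr_ge0 ?(ltW E0) //.
by apply: mulr_ge0 T0; rewrite mulr_ge0 ?expR_ge0.
Qed.
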